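(* Let $R=k[\sigma^{\vee}\cap M]$ be a $\mathbb{Q}$-Gorenstein toric ring over a field $k$ of characteristic $p>0$, and let $w\in M_{\mathbb{R}}$ be such that $\langle w,n_i\rangle=1$ for $i=1,\dots,s$, where $n_1,\dots,n_s$ are the primitive generators of $\sigma$. Then for any nonzero toric ideal $\mathfrak{a}\subseteq R$, $$\tau(\mathfrak{a})=\mathcal{J}(\mathfrak{a})$$ and it is again a toric ideal. Moreover, for $m\in M$, the following conditions are equivalent to each other. (1) $x^m\in\tau(\mathfrak{a})$. (2) $m+w\in\operatorname{Int}(P(\mathfrak{a}))$. (3) $x^m\in\mathcal{J}(\mathfrak{a})$.
   Context: Toric setup. $M=\mathbb{Z}^d$, $N=\operatorname{Hom}_{\mathbb{Z}}(M,\mathbb{Z})$, $M_{\mathbb{R}}=M\otimes\mathbb{R}$, $N_{\mathbb{R}}=N\otimes\mathbb{R}$, with duality pairing $\langle\,,\rangle\colon M_{\mathbb{R}}\times N_{\mathbb{R}}\to\mathbb{R}$. $\sigma\subset N_{\mathbb{R}}$ is a strongly convex rational polyhedral cone with primitive generators $n_1,\dots,n_s\in N$ (corresponding to the toric divisors $D_1,\dots,D_s$ of $\operatorname{Spec} R$), and $\sigma^{\vee}=\{m\in M_{\mathbb{R}}\mid\langle m,n\rangle\ge0\ \forall n\in\sigma\}$. $R=k[\sigma^{\vee}\cap M]$ is the $k$-algebra spanned by the monomials $x^m=x_1^{m_1}\cdots x_d^{m_d}$, $m\in\sigma^{\vee}\cap M$. A toric ideal is an ideal of $R$ generated by monomials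 $x^m$. $P(\mathfrak{a})\subset M_{\mathbb{R}}$ is the Newton polygon of $\mathfrak{a}$: the convex hull of $\{m\in M\mid x^m\in\mathfrak{a}\}$, and $\operatorname{Int}$ is its relative interior in $M_{\mathbb{R}}$. $R$ being $\mathbb{Q}$-Gorenstein means that $\omega_R^{(r)}$ is principal for some $r\ge1$; then a vector $w$ as in the claim exists (if $\omega_R^{(r)}=x^{m_0}R$ with $\langle m_0,n_i\rangle=r$ for all $i$, take $w=m_0/r$). Multiplier ideal. Let $f\colon X\to Y=\operatorname{Spec} R$ be a log resolution of the toric ideal $\mathfrak{a}\neq0$ in the toric category (it exists in any characteristic): $X$ is regular, $\mathfrak{a}\mathcal{O}_X=\mathcal{O}_X(-Z)$ is invertible, and $\operatorname{Exc}(f)\cup\operatorname{Supp} Z$ is a simple normal crossing divisor. Then $\mathcal{J}(\mathfrak{a})=H^0(X,\mathcal{O}_X(\lceil K_{X/Y}-Z\rceil))$, where $K_{X/Y}=K_X-f^*K_Y$. The ideal $\tau(\mathfrak{a})$. $R^{\circ}$ is the set of elements not in any minimal prime; $q=p^e$; $I^{[q]}$ is the ideal generated by $q$-th powers of elements of $I$. For ideals $\mathfrak{a},I$, $I^{*\mathfrak{a}}$ is the set of $z\in R$ for which there is $c\in R^{\circ}$ with $cz^q\mathfrak{a}^q\subseteq I^{[q]}$ for all large $q=p^e$ ($\mathfrak{a}^q$ the ordinary power). For the excellent reduced ring $R$, $\tau(\mathfrak{a})=\bigcap_{I\subseteq R}(I:I^{*\mathfrak{a}})$, $I$ running over all ideals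 of $R$. *)

(* Defs.v *)
From HB Require Import structures.
From mathcomp Require Import all_boot all_order all_algebra.
From mathcomp Require Import boolp classical_sets functions cardinality reals.
From mathcomp Require Import topology.
(* The notations of mpoly clash with those of MathComp-Analysis. *)
From mathcomp Require Import -(notations) mpoly.

Set Implicit Arguments.
Unset Strict Implicit.
Unset Printing Implicit Defensive.

Import Order.TTheory GRing.Theory Num.Theory.
Import numFieldTopology.Exports.
Local Open Scope classical_set_scope.
Local Open Scope ring_scope.

(* Rings and (fractional) ideals are subsets of an ambient commutative ring K;
   A and R below stand for subrings of K. *)
Section Ideals.
Variable K : comNzRingType.
Implicit Types (A R I J P a : set K).

Definition is_submodule A I : Prop :=
  [/\ I 0, forall x y, I x -> I y -> I (x + y)
         & forall r x, A r -> I x -> I (r * x)].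

Definition submodule_gen A (S : set K) : set K :=
  [set x | forall I, is_submodule A I -> S `<=` I -> I x].

Definition is_ideal R I : Prop := I `<=` R /\ is_submodule R I.

Definition principal A (g : K) : set K := [set g * x | x in A].

(* I is an invertible A-module: 1 is in I . (A : I), the colon in K. *)
Definition invertible A I : Prop :=
  exists (t : nat) (u v : 'I_t -> K),
    [/\ forall i, I (u i), forall i x, I x -> A (v i * x)
      & \sum_i u i * v i = 1].

Definition ideal_pow R a (n : nat) : set K :=
  submodule_gen R
    [set \prod_i u i | u in [set u : 'I_n -> K | forall i, a (u i)]].

Definition ideal_colon R I J : set K :=
  [set z | R z /\ forall y, J y -> I (z * y)].

Definition is_prime R P : Prop :=
  [/\ is_ideal R P, ~ P 1
    & forall x y, R x -> R y -> P (x * y) -> P x \/ P y].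

Definition is_minimal_prime R P : Prop :=
  is_prime R P /\ forall Q, is_prime R Q -> Q `<=` P -> Q = P.

Definition ring_circ R : set K :=
  [set c | R c /\ forall P, is_minimal_prime R P -> ~ P c].

(* I^[q] *)
Definition frobenius_power R I (q : nat) : set K :=
  submodule_gen R [set x ^+ q | x in I].

(* I^{*a} *)
Definition tight_closure R (p : nat) a I : set K :=
  [set z | R z /\
    exists2 c, ring_circ R c &
      exists e0 : nat, forall e : nat, (e0 <= e)%N ->
        forall y, ideal_pow R a (p ^ e) y ->
          frobenius_power R I (p ^ e) (c * z ^+ (p ^ e) * y)].

Definition tau R (p : nat) a : set K :=
  [set z | R z /\ forall I, is_ideal R I ->
     ideal_colon R I (tight_closure R p a I) z].

End Ideals.

Section Convexity.
Variables (RR : realType) (d : nat).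
Implicit Type S : set 'rV[RR]_d.

Definition affine_hull S : set 'rV[RR]_d :=
  [set y | exists (t : nat) (c : 'I_t -> RR) (x : 'I_t -> 'rV[RR]_d),
     [/\ \sum_i c i = 1, forall i, S (x i) & y = \sum_i c i *: x i]].

Definition convex_hull S : set 'rV[RR]_d :=
  [set y | exists (t : nat) (c : 'I_t -> RR) (x : 'I_t -> 'rV[RR]_d),
     [/\ forall i, 0 <= c i, \sum_i c i = 1, forall i, S (x i)
       & y = \sum_i c i *: x i]].

Definition relative_interior S : set 'rV[RR]_d :=
  [set x | S x /\ exists2 U, nbhs x U & U `&` affine_hull S `<=` S].

End Convexity.

(* M = 'rV[int]_d and N = Hom(M, Z) = 'cV[int]_d, and likewise over RR. *)
Definition pairing (A : pzRingType) (d : nat) (m : 'rV[A]_d) (v : 'cV[A]_d)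
  : A := (m *m v) 0 0.

Section Cones.
Variables (RR : realType) (d : nat).
Implicit Types (sigma tau : set 'cV[RR]_d) (v : 'cV[int]_d).

Definition cone_gen (t : nat) (u : 'I_t -> 'cV[int]_d) : set 'cV[RR]_d :=
  [set x | exists2 c : 'I_t -> RR,
     forall i, 0 <= c i & x = \sum_i c i *: map_mx intr (u i)].

Definition strongly_convex_rational_cone sigma : Prop :=
  (exists (t : nat) (u : 'I_t -> 'cV[int]_d), sigma = cone_gen u) /\
  (forall x, sigma x -> sigma (- x) -> x = 0).

Definition dual_cone sigma : set 'rV[RR]_d :=
  [set m | forall x, sigma x -> 0 <= pairing m x].

Definition is_face sigma tau : Prop :=
  exists2 m, dual_cone sigma m & tau = [set x | sigma x /\ pairing m x = 0].

Definition faces sigma : set (set 'cV[RR]_d) := [set tau | is_face sigma tau].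

Definition ray v : set 'cV[RR]_d :=
  [set x | exists2 c : RR, 0 <= c & x = c *: map_mx intr v].

(* This excludes v = 0 = 2 *: 0. *)
Definition primitive v : Prop :=
  forall (c : int) (u : 'cV[int]_d), v = c *: u -> c \is a GRing.unit.

(* The primitive generators v of the rays of Sigma; they index the
   torus-invariant prime divisors D_v of the toric variety of Sigma. *)
Definition fan_rays (Sigma : set (set 'cV[RR]_d)) : set 'cV[int]_d :=
  [set v | primitive v /\ Sigma (ray v)].

Definition regular_cone sigma : Prop :=
  exists2 B : 'M[int]_d, B \in unitmx & exists I : {set 'I_d},
    sigma = [set x | exists2 c : 'I_d -> RR, forall i, 0 <= c i &
               x = \sum_(i in I) c i *: map_mx intr (col i B)].

Record is_fan (Sigma : set (set 'cV[RR]_d)) : Prop := {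
  fan_finite : finite_set Sigma;
  fan_cones : forall tau, Sigma tau -> strongly_convex_rational_cone tau;
  fan_faces : forall tau rho, Sigma tau -> is_face tau rho -> Sigma rho;
  fan_inter : forall tau rho, Sigma tau -> Sigma rho ->
    is_face tau (tau `&` rho) /\ is_face rho (tau `&` rho) }.

End Cones.

(* k(x_1, ..., x_d), the function field of every toric variety of the torus
   with character lattice M *)
Definition ratfun (k : fieldType) (d : nat) : fieldType :=
  {fraction mpoly d k}.

Section Toric.
Variables (RR : realType) (k : fieldType) (d : nat).
Local Notation K := (ratfun k d).
Implicit Types (m : 'rV[int]_d) (v : 'cV[int]_d) (sigma : set 'cV[RR]_d).

Definition monomial m : K :=
  \prod_(i < d) (tofrac (mpolyX k (mnm1 i)) : K) ^ (m 0 i).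

Definition monomial_span (S : set 'rV[int]_d) : set K :=
  [set f | exists (t : nat) (c : 'I_t -> k) (m : 'I_t -> 'rV[int]_d),
     (forall i, S (m i)) /\
     f = \sum_i (tofrac (mpolyC d (c i)) : K) * monomial (m i)].

Definition dual_lattice_points sigma : set 'rV[int]_d :=
  [set m | dual_cone sigma (map_mx intr m)].

(* k[sigma^vee \cap M], the coordinate ring of the affine toric chart U_sigma;
   for sigma = 0 this is k[M], the coordinate ring of the torus. *)
Definition toric_ring sigma : set K :=
  monomial_span (dual_lattice_points sigma).

Definition is_toric_ideal sigma (a : set K) : Prop :=
  exists2 S : set 'rV[int]_d, S `<=` dual_lattice_points sigma &
    a = submodule_gen (toric_ring sigma) [set monomial m | m in S].

Definition newton_polygon (a : set K) : set 'rV[RR]_d :=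
  convex_hull [set map_mx intr m | m in [set m | a (monomial m)]].

(* The local ring at the generic point of D_v: the localization of the chart
   k[v^vee \cap M] at the prime ideal of D_v, which is spanned by the monomials
   x^m with <m, v> > 0. *)
Definition divisor_local_ring v : set K :=
  [set f | exists a b, [/\ monomial_span [set m | 0 <= pairing m v] a,
     monomial_span [set m | 0 <= pairing m v] b,
     ~ monomial_span [set m | 0 < pairing m v] b & f = a / b]].

(* The valuation of the discrete valuation ring above, for f != 0: for
   primitive v, the monomials x^m with <m, v> = j have order j along D_v. *)
Definition ord v (f : K) : int :=
  xget 0 [set j | exists2 m, pairing m v = j &
    divisor_local_ring v (f / monomial m) /\
    divisor_local_ring v (monomial m / f)].

(* The order along D_v of an ideal a, i.e. of a generator of the extension of
   a to the local ring of D_v. This is the coefficient of D_v in Z when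
   a O_X = O_X(-Z). *)
Definition ideal_ord (a : set K) v : int :=
  xget 0 [set j | exists h, [/\ h != 0,
    submodule_gen (divisor_local_ring v) a = principal (divisor_local_ring v) h
    & ord v h = j]].

(* H^0(X, O_X(D)) = {f | f = 0 or div f + D >= 0} for X the toric variety of
   Sigma and D = \sum_v D(v) D_v. The prime divisors meeting the torus do not
   occur in D; along these, div f >= 0 says that f is regular on the torus. *)
Definition divisor_sections (Sigma : set (set 'cV[RR]_d))
    (D : 'cV[int]_d -> int) : set K :=
  [set f | toric_ring [set 0] f /\
     (f = 0 \/ forall v, fan_rays Sigma v -> 0 <= ord v f + D v)].

(* omega_R^(r) = H^0(Spec R, O(r K_Y)) with K_Y = - \sum_i D_i *)
Definition canonical_power sigma (r : nat) : set K :=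
  divisor_sections (faces sigma) (fun=> - r%:Z).

(* The toric variety X of Sigma, with its toric morphism f to Y = U_sigma that
   is the identity on the torus, is a log resolution of the ideal a. *)
Record is_log_resolution sigma (a : set K)
    (Sigma : set (set 'cV[RR]_d)) : Prop := {
  res_fan : is_fan Sigma;
  (* f is defined and proper *)
  res_support : \bigcup_(tau in Sigma) tau = sigma;
  res_regular : forall tau, Sigma tau -> regular_cone tau;
  res_invertible : forall tau, Sigma tau ->
    invertible (toric_ring tau) (submodule_gen (toric_ring tau) a);
  (* f is a local isomorphism along the orbit of tau iff tau is a face of
     sigma. The condition says that Exc(f) \cup Supp Z has pure codimension 1;
     being torus-invariant on a regular X, it then has simple normal
     crossings. *)
  res_snc : forall tau, Sigma tau -> ~ is_face sigma tau ->
    exists2 v, fan_rays (faces tau) v &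
      ~ is_face sigma (ray v) \/ ideal_ord a v <> 0 }.

(* If omega_R^(r) = g R then r K_Y = - div g, so f^* K_Y = - (1/r) div_X g,
   while K_X = - \sum_v D_v. *)
Definition relative_canonical (r : nat) (g : K) v : rat :=
  - 1 + (ord v g)%:Q / r%:Q.

Definition multiplier_ideal (Sigma : set (set 'cV[RR]_d)) (r : nat) (g : K)
    (a : set K) : set K :=
  divisor_sections Sigma
    (fun v => Num.ceil (relative_canonical r g v - (ideal_ord a v)%:Q)).

End Toric.

Arguments monomial k {d} m.
Arguments toric_ring {RR} k {d} sigma.
Arguments newton_polygon RR {k d} a.
Arguments canonical_power {RR} k {d} sigma r.

(* Main.v *)
(* Write S = sigma^vee \cap M, A for the set of m with x^m in a, and
   T = {m | m + w \in Int P(a)}; both ideals are the k-span of the x^m, m in T.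
   By Farkas' lemma and Dickson's lemma, y is interior to P(a) iff for every
   nonzero v in sigma some m in A has <m, v> < <y, v>.

   The x^m with m in T lie in tau: write m + w - eta xi, with xi interior to
   sigma^vee, as a convex combination of A and round its q-th multiple to an
   exponent u of a^q.
   For c in R nonzero, the q^-1-linear map sending x^(q l + b) to x^l, where
   b = gamma + u - q m for an exponent gamma of c, preserves R and sends c x^u
   to x^m, so c y^q x^u in I^[q] gives x^m y in I.

   Conversely, tau lies in their span: let m be an exponent of z with m + w not
   interior, let t be deep in S, and let I be spanned by the x^u, u in S, with
   t - u not in S. A separating v in sigma is a nonnegative combination of the
   n_i, which yields x^(t - m) in I^{*a} with c = 1, while z x^(t - m) has the
   exponent t and hence is not in I.

   For the multiplier ideal, the condition along D_v reads
   min_A <-, v> < <m + w, v>, and the minimum is linear on the cones of the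
   resolution because a becomes locally principal there. *)
Require Import Defs.
From HB Require Import structures.
From mathcomp Require Import all_boot all_order all_algebra.
From mathcomp Require Import boolp classical_sets functions cardinality reals.
From mathcomp Require Import topology.
From mathcomp Require Import -(notations) mpoly.
From mathcomp Require Import ring lra zify.

Set Implicit Arguments.
Unset Strict Implicit.
Unset Printing Implicit Defensive.

Import Order.TTheory GRing.Theory Num.Theory.
Import numFieldTopology.Exports.
Local Open Scope classical_set_scope.
Local Open Scope ring_scope.

(** * Farkas' lemma and rational cones *)

(** The number 1 = <w, n_i> acts in two dual ways. For membership in tau it is the slack that lets
    the bound <b, n_i> < q survive division by q. For the upper bound it is matched by lattice
    points x_i with <x_i, n_i> = -1, just beyond one facet of sigma^vee; they exist because n_i is
    primitive and spans a face.

    P(a) is an unbounded hull of infinitely many lattice points, and a separating v may be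
    irrational. Dickson's lemma replaces A by a finite subset on which every v in sigma attains its
    minimum, and only then does Farkas' lemma apply. Real vectors of sigma^vee are rounded to
    lattice points; a multiple of a lattice point xi interior to sigma^vee absorbs the bounded
    error.

    The field k may be infinite over its subfield of q-th powers, so the coefficient part of the
    q^-1-linear map is obtained from Zorn's lemma. The function field has no coefficients, so those
    of Laurent polynomials are built by hand; the orders along divisors are then read off from
    supports. *)

Lemma pairingDl (A : pzRingType) d (m m' : 'rV[A]_d) v :
  pairing (m + m') v = pairing m v + pairing m' v.
Proof. by rewrite /pairing mulmxDl mxE. Qed.

Lemma pairingDr (A : pzRingType) d (m : 'rV[A]_d) v v' :
  pairing m (v + v') = pairing m v + pairing m v'.
Proof. by rewrite /pairing mulmxDr mxE. Qed.

Lemma pairingNl (A : pzRingType) d (m : 'rV[A]_d) v :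
  pairing (- m) v = - pairing m v.
Proof. by rewrite /pairing mulNmx mxE. Qed.

Lemma pairingNr (A : pzRingType) d (m : 'rV[A]_d) v :
  pairing m (- v) = - pairing m v.
Proof. by rewrite /pairing mulmxN mxE. Qed.

Lemma pairingBl (A : pzRingType) d (m m' : 'rV[A]_d) v :
  pairing (m - m') v = pairing m v - pairing m' v.
Proof. by rewrite pairingDl pairingNl. Qed.

Lemma pairingZl (A : pzRingType) d a (m : 'rV[A]_d) v :
  pairing (a *: m) v = a * pairing m v.
Proof. by rewrite /pairing -scalemxAl mxE. Qed.

Lemma pairingZr (A : comPzRingType) d a (m : 'rV[A]_d) v :
  pairing m (a *: v) = a * pairing m v.
Proof. by rewrite /pairing -scalemxAr mxE. Qed.

Lemma pairing0l (A : pzRingType) d (v : 'cV[A]_d) : pairing 0 v = 0.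
Proof. by rewrite /pairing mul0mx mxE. Qed.

Lemma pairing0r (A : pzRingType) d (m : 'rV[A]_d) : pairing m 0 = 0.
Proof. by rewrite /pairing mulmx0 mxE. Qed.

Lemma pairing_suml (A : pzRingType) d (I : Type) (r : seq I) P
    (m : I -> 'rV[A]_d) v :
  pairing (\sum_(i <- r | P i) m i) v = \sum_(i <- r | P i) pairing (m i) v.
Proof. by rewrite /pairing mulmx_suml summxE. Qed.

Lemma pairing_sumr (A : pzRingType) d (I : Type) (r : seq I) P
    (m : 'rV[A]_d) (v : I -> 'cV[A]_d) :
  pairing m (\sum_(i <- r | P i) v i) = \sum_(i <- r | P i) pairing m (v i).
Proof. by rewrite /pairing mulmx_sumr summxE. Qed.

Lemma pairingMn (A : pzRingType) d (m : 'rV[A]_d) v q :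
  pairing (m *+ q) v = pairing m v *+ q.
Proof. by elim: q => [|q IH]; rewrite ?mulr0n ?pairing0l // !mulrS pairingDl
  IH. Qed.

Lemma pairing_map (A B : pzRingType) (f : {rmorphism A -> B}) d
    (m : 'rV[A]_d) (v : 'cV[A]_d) :
  pairing (map_mx f m) (map_mx f v) = f (pairing m v).
Proof. by rewrite /pairing -map_mxM mxE. Qed.

Lemma pairing_intr (A : pzRingType) d (m : 'rV[int]_d) (v : 'cV[int]_d) :
  pairing (map_mx intr m) (map_mx intr v) = (pairing m v)%:~R :> A.
Proof. exact: (pairing_map (intr : {rmorphism int -> A})). Qed.

Lemma pairing_delta_l (A : pzRingType) d j (v : 'cV[A]_d) :
  pairing (delta_mx 0 j) v = v j 0.
Proof. by rewrite /pairing -rowE mxE. Qed.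

Lemma pairing_delta_r (A : pzRingType) d j (m : 'rV[A]_d) :
  pairing m (delta_mx j 0) = m 0 j.
Proof. by rewrite /pairing -colE mxE. Qed.

Lemma pairingE (A : pzRingType) d (m : 'rV[A]_d) (v : 'cV[A]_d) :
  pairing m v = \sum_j m 0 j * v j 0.
Proof. by rewrite /pairing mxE. Qed.

(* Induction on the number of generators: if the functional separating b from
   the tail is negative on the head, project along the head onto its kernel. *)
Lemma farkas_seq (F : realFieldType) d (I : eqType) (r : seq I) :
  uniq r -> forall (u : I -> 'cV[F]_d) (b : 'cV[F]_d),
  (exists2 c : I -> F, forall i, 0 <= c i & b = \sum_(i <- r) c i *: u i) \/
  (exists2 m : 'rV[F]_d, forall i, i \in r -> 0 <= pairing m (u i) &
     pairing m b < 0).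
Proof.
elim: r => [_ u b|i0 r IH /= /andP[i0r ur] u b].
  have [->|b0] := eqVneq b 0.
    by left; exists (fun=> 0) => //; rewrite big_nil.
  right; exists (- b^T) => //.
  rewrite pairingNl oppr_lt0 pairingE.
  have [j bj] : exists j, b j 0 != 0.
    apply: contrapT => h; move/eqP: b0; apply.
    apply/matrixP => j k; rewrite (ord1 k) mxE; apply/eqP/negPn/negP => bj.
    by apply: h; exists j.
  rewrite (bigD1 j) //= ltr_pwDl //.
    by rewrite mxE -expr2 lt_neqAle sqr_ge0 eq_sym sqrf_eq0 bj.
  by apply: sumr_ge0 => i _; rewrite mxE -expr2 sqr_ge0.
have glue (c : I -> F) x : (forall i, 0 <= c i) -> 0 <= x ->
    b = x *: u i0 + \sum_(i <- r) c i *: u i ->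
    exists2 c : I -> F, forall i, 0 <= c i &
      b = \sum_(i <- i0 :: r) c i *: u i.
  move=> c0 x0 ->; exists (fun i => if i == i0 then x else c i).
    by move=> i; case: ifP.
  rewrite big_cons eqxx; congr (_ + _); rewrite !big_seq.
  by apply: eq_bigr => i ir; case: eqP => // ii; rewrite -ii ir in i0r.
have [[c c0 bE]|[v v0 vb]] := IH ur u b.
  by left; apply: (glue c 0) => //; rewrite scale0r add0r.
have [ge|lt] := leP 0 (pairing v (u i0)).
  by right; exists v => // i; rewrite inE => /orP[/eqP->|/v0].
set pr := fun x => x - (pairing v x / pairing v (u i0)) *: u i0.
have [[c c0 bE]|[m m0 mb]] := IH ur (pr \o u) (pr b).
  left; apply: (glue c ((pairing v b - \sum_(i <- r) c i * pairing v (u i))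
                         / pairing v (u i0))) => //.
    rewrite mulr_le0 ?invr_le0 1?ltW // subr_lt0 (lt_le_trans vb) //.
    by rewrite big_seq sumr_ge0 // => i ir; rewrite mulr_ge0 // v0.
  move: bE; rewrite /pr /= => /eqP; rewrite subr_eq => /eqP {1}->.
  under eq_bigr do rewrite scalerBr scalerA mulrA.
  rewrite sumrB -scaler_suml -mulr_suml mulrBl scalerBl.
  by rewrite addrAC [RHS]addrC addrA.
right; exists (m - (pairing m (u i0) / pairing v (u i0)) *: v).
  have pE x : pairing (m - (pairing m (u i0) / pairing v (u i0)) *: v) x =
      pairing m (pr x).
    rewrite pairingBl pairingZl /pr pairingDr pairingNr pairingZr.
    by congr (_ - _); ring.
  move=> i; rewrite inE => /orP[/eqP->|ir]; last by rewrite pE m0.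
  by rewrite pE /pr divff ?lt_eqF // scale1r subrr pairing0r.
rewrite pairingBl pairingZl; move: mb; rewrite /pr pairingDr pairingNr
  pairingZr.
by rewrite [X in _ - X < 0 -> _]mulrC mulrA [pairing m _ * _ / _]mulrAC.
Qed.

Lemma farkas (F : realFieldType) d (I : finType) (u : I -> 'cV[F]_d) b :
  (exists2 c : I -> F, forall i, 0 <= c i & b = \sum_i c i *: u i) \/
  (exists2 m : 'rV[F]_d, forall i, 0 <= pairing m (u i) & pairing m b < 0).
Proof.
have [] := farkas_seq (index_enum_uniq I) u b; first by left.
by case=> m m0 mb; right; exists m => // i; apply: m0; rewrite mem_index_enum.
Qed.

Lemma clear_denominators d (m : 'rV[rat]_d) :
  exists2 c : int, 0 < c & exists m' : 'rV[int]_d,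
    map_mx intr m' = c%:~R *: m.
Proof.
exists (\prod_j denq (m 0 j)); first by apply: prodr_gt0 => j _;
  exact: denq_gt0.
exists (\row_j (numq (m 0 j) * \prod_(i | i != j) denq (m 0 i))).
apply/rowP => j; rewrite !mxE [in RHS](bigD1 j) //= !rmorphM /= numqE.
by ring.
Qed.

(* Farkas over rat yields either an integral functional or a rational
   relation, and the latter persists over RR. *)
Lemma integral_functional (RR : realFieldType) d (I : finType)
    (u : I -> 'cV[int]_d) (b : 'cV[int]_d) (m : 'rV[RR]_d) :
  (forall i, 0 <= pairing m (map_mx intr (u i))) ->
  0 < pairing m (map_mx intr b) ->
  exists m' : 'rV[int]_d,
    (forall i, 0 <= pairing m' (u i)) /\ 0 < pairing m' b.
Proof.
move=> m0 mb.
have [[c c0 bE]|[m1 m10 m1b]] :=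
  farkas (fun i => map_mx intr (u i) : 'cV[rat]_d) (- map_mx intr b).
  exfalso.
  have : map_mx ratr (- map_mx intr b : 'cV[rat]_d) = - map_mx intr b :>
    'cV[RR]_d.
    by apply/matrixP => i j; rewrite !mxE rmorphN /= ratr_int.
  rewrite bE.
  have -> : map_mx ratr (\sum_i c i *: map_mx intr (u i)) =
     \sum_i (ratr (c i)) *: map_mx intr (u i) :> 'cV[RR]_d.
    apply/matrixP => i j; rewrite mxE !summxE rmorph_sum; apply: eq_bigr => l _.
    by rewrite !mxE rmorphM /= ratr_int.
  move=> /(congr1 (pairing m)); rewrite pairingNr pairing_sumr => sE.
  have : 0 <= - pairing m (map_mx intr b).
    by rewrite -sE sumr_ge0 // => i _; rewrite pairingZr mulr_ge0 // ler0q.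
  by rewrite oppr_ge0 leNgt mb.
have [c cp [m' m'E]] := clear_denominators m1.
have pE x : (pairing m' x)%:~R = c%:~R * pairing m1 (map_mx intr x) :> rat.
  by rewrite -pairing_intr m'E pairingZl.
exists m'; split => [i|].
  by rewrite -(ler0z rat) pE mulr_ge0 // ler0z ltW.
rewrite -(ltr0z rat) pE mulr_gt0 ?ltr0z //.
by move: m1b; rewrite pairingNr oppr_lt0.
Qed.

(** Induction on the coordinates. A finite set [F0] settles the remaining ones, and it also settles
    [i0] for every x with [h x i0] at least [N]. The rest of [A] falls into the finitely many slices
    [h x i0 = j] with [j < N], each settled by induction. *)
Lemma dickson (T : eqType) (s : nat) (h : T -> 'I_s -> nat) (A : set T) :
  exists F : seq T, (forall x, x \in F -> A x) /\
    forall x, A x -> exists2 y, y \in F & forall i, (h y i <= h x i)%N.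
Proof.
suff H (r : seq 'I_s) : forall A : set T, exists F : seq T,
    (forall x, x \in F -> A x) /\ forall x, A x ->
      exists2 y, y \in F & forall i, i \in r -> (h y i <= h x i)%N.
  have [F [FA FP]] := H (enum 'I_s) A; exists F; split=> // x /FP[y yF yP].
  by exists y => // i; apply: yP; rewrite mem_enum.
elim: r => [|i0 r IH] {}A.
  have [[x Ax]|nA] := pselect (exists x, A x).
    by exists [:: x]; split=> [y|y _]; [rewrite inE => /eqP->|exists x;
      rewrite ?inE].
  by exists [::]; split=> // x Ax; case: nA; exists x.
have [F0 [F0A F0P]] := IH A.
have [F FP] := choice (fun j => IH [set x | A x /\ h x i0 = j]).
set N := (\sum_(y <- F0) h y i0)%N.
exists (F0 ++ flatten [seq F j | j <- iota 0 N]); split=> x.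
  rewrite mem_cat => /orP[/F0A //|/flatten_mapP[j _ xj]].
  by have [/(_ x xj)[]] := FP j.
move=> Ax; have [Nx|xN] := leqP N (h x i0).
  have [y yF yP] := F0P x Ax; exists y; first by rewrite mem_cat yF.
  move=> i; rewrite inE => /orP[/eqP->|/yP //]; apply: leq_trans Nx.
  by rewrite /N (big_rem y) //= leq_addr.
have [FA /(_ x (conj Ax erefl))[y yF yP]] := FP (h x i0).
exists y; first by rewrite mem_cat; apply/orP; right; apply/flatten_mapP;
  exists (h x i0) => //; rewrite mem_iota.
move=> i; rewrite inE => /orP[/eqP->|/yP //].
by have [_ ->] := FA y yF.
Qed.

Lemma primitive_neq0 d (v : 'cV[int]_d) : primitive v -> v != 0.
Proof.
move=> pv; apply/eqP => v0; have := pv 2 v.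
by rewrite v0 scaler0 => /(_ erefl).
Qed.

(** Dividing a non-primitive vector by a nonunit lowers the sum of the absolute values of its
    entries. The sign goes into the vector, so that the multiplier stays positive. *)
Lemma primitive_multiple d (u : 'cV[int]_d) : u != 0 ->
  exists2 v, primitive v & exists2 c : nat, (0 < c)%N & u = c%:Z *: v.
Proof.
have [N] := ubnP (\sum_j `|u j 0%R|)%N; elim: N u => // N IH u uN u0.
have [pu|] := pselect (primitive u).
  by exists u => //; exists 1%N => //; rewrite scale1r.
move=> /existsNP[c /existsNP[u' /not_implyP[uE cU]]].
have c0 : c != 0 by apply: contraNneq u0 => c0; rewrite uE c0 scale0r.
have u'0 : u' != 0 by apply: contraNneq u0 => u'0; rewrite uE u'0 scaler0.
have c1 : (1 < `|c|)%N.
  have {}cU : ~ ((c == 1) || (c == -1)) by []. lia.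
wlog cp : c u' uE c0 u'0 c1 cU / 0 < c.
  move=> W; have [cn|cp] := ltP 0 c; first exact: (W c u').
  apply: (W (- c) (- u')); rewrite ?oppr_eq0 ?abszN //.
  - by rewrite scalerN scaleNr opprK.
  - by rewrite unitrN.
  - by rewrite oppr_gt0 lt_neqAle c0.
have sE : (\sum_j `|u j 0%R| = `|c| * \sum_j `|u' j 0%R|)%N.
  by rewrite big_distrr /=; apply: eq_bigr => j _; rewrite uE mxE abszM.
have u'p : (0 < \sum_j `|u' j 0%R|)%N.
  rewrite lt0n; apply: contra u'0; rewrite sum_nat_eq0 => /forallP h.
  by apply/eqP/colP => j; rewrite mxE; apply/eqP; rewrite -absz_eq0;
    have := h j.
have [|v pv [c' c'p u'E]] := IH u' _ u'0.
  by rewrite ltnS in uN; apply: leq_trans uN; rewrite sE ltn_Pmull.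
exists v => //; exists (`|c| * c')%N; first by rewrite muln_gt0 c'p ltnW.
by rewrite uE u'E scalerA PoszM gtz0_abs.
Qed.

(** The least positive value [t] taken by the pairing with [v] divides every entry of [v], by
    division with remainder. Primitivity then forces [t] to be 1. *)
Lemma primitive_bezout d (v : 'cV[int]_d) : primitive v ->
  exists e : 'rV[int]_d, pairing e v = 1.
Proof.
move=> pv; have v0 := primitive_neq0 pv.
pose P t := (0 < t)%N && `[< exists e : 'rV[int]_d, pairing e v = t%:Z >].
have exP : exists t, P t.
  have [j vj] : exists j, v j ord0 != 0.
    apply: contrapT => h; move/eqP: v0; apply; apply/colP => j; rewrite mxE.
    by apply/eqP/negPn/negP => vj; apply: h; exists j.
  exists `|v j ord0|%N; rewrite /P absz_gt0 vj; apply/asboolP.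
  exists (Num.sg (v j ord0) *: delta_mx 0 j).
  by rewrite pairingZl pairing_delta_l abszE normrEsg.
case: (ex_minnP exP) => t /andP[t0 /asboolP[e eE]] tmin.
have tv j : (t%:Z %| v j ord0)%Z.
  rewrite /dvdz; apply/negPn/negP => mod0.
  have t0' : t%:Z != 0 by rewrite eqz_nat -lt0n.
  have := tmin `|(v j ord0 %% t)%Z|%N; rewrite /P.
  have -> : (0 < `|(v j ord0 %% t)%Z|)%N.
    rewrite absz_gt0; apply: contra mod0 => /eqP m0; exact/dvdz_mod0P.
  rewrite leqNgt -ltz_nat gez0_abs ?modz_ge0 // ltz_pmod //= => h.
  suff: false by []. apply: h; apply/asboolP.
  exists (delta_mx 0 j - (v j ord0 %/ t)%Z *: e).
  rewrite pairingBl pairingZl pairing_delta_l eE; apply/eqP.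
  by rewrite subr_eq addrC -divz_eq.
have vE : v = t%:Z *: (\col_j (v j ord0 %/ t)%Z).
  by apply/colP => j; rewrite !mxE mulrC divzK.
have tU := pv _ _ vE; exists e; rewrite eE.
have {}tU : (t%:Z == 1) || (t%:Z == -1) by []. lia.
Qed.

Section Cone.
Variables (RR : realType) (d : nat).
Implicit Types (sigma : set 'cV[RR]_d) (v : 'cV[int]_d).
Local Notation real := (map_mx (intr : int -> RR)).

Lemma real_eq0 v : (real v == 0) = (v == 0).
Proof.
apply/eqP/eqP => [/matrixP h|->]; last by rewrite map_mx0.
by apply/matrixP => i j; have /eqP := h i j; rewrite !mxE intr_eq0 => /eqP.
Qed.

Lemma cone_gen_sum (I : finType) (P : pred I) t (u : 'I_t -> 'cV[int]_d)
    (x : I -> 'cV[RR]_d) :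
  (forall i, P i -> cone_gen u (x i)) -> cone_gen u (\sum_(i | P i) x i).
Proof.
move=> h; apply: big_ind => //.
  by exists (fun=> 0) => //; rewrite big1 // => i _; rewrite scale0r.
move=> y z [c c0 ->] [c' c'0 ->]; exists (fun i => c i + c' i).
  by move=> i; rewrite addr_ge0.
by rewrite -big_split; apply: eq_bigr => i _; rewrite scalerDl.
Qed.

Lemma cone_genZ t (u : 'I_t -> 'cV[int]_d) (a : RR) x :
  0 <= a -> cone_gen u x -> cone_gen u (a *: x).
Proof.
move=> a0 [c c0 ->]; exists (fun i => a * c i) => [i|].
  by rewrite mulr_ge0.
by rewrite scaler_sumr; apply: eq_bigr => i _; rewrite scalerA.
Qed.

Lemma cone_gen_mem t (u : 'I_t -> 'cV[int]_d) i : cone_gen u (real (u i)).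
Proof.
exists (fun j => (j == i)%:R) => [j|]; first exact: ler0n.
rewrite (bigD1 i) //= eqxx scale1r big1 ?addr0 // => j /negPf->.
by rewrite scale0r.
Qed.

(** The [n i] are given by faces, the cone by arbitrary generators. In a minimal generating family
    [J] each member spans a face: some functional vanishes on it and is positive on the others. The
    primitive vector on its ray is therefore one of the [n i]. *)
Lemma cone_genP sigma (s : nat) (n : 'I_s -> 'cV[int]_d) :
  strongly_convex_rational_cone sigma -> range n = fan_rays (faces sigma) ->
  sigma = cone_gen n.
Proof.
move=> [[t [u ->]] sc] hn.
have raysub i : ray (n i) `<=` (cone_gen u : set 'cV[RR]_d).
  have : range n (n i) by exists i.
  by rewrite hn => -[_ [m _ ->]] x [].
rewrite predeqE => x; split; last first.
  move=> [c c0 ->]; apply: cone_gen_sum => i _; apply: (raysub i).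
  by exists (c i).
pose gens (J : {set 'I_t}) := `[< forall x, cone_gen u x ->
  exists2 c : 'I_t -> RR, forall i, 0 <= c i & x = \sum_(i in J) c i *: real (u
    i) >].
have gT : gens [set: 'I_t]%SET.
  apply/asboolP => y [c c0 ->]; exists c => //.
  by apply: eq_bigl => i; rewrite inE.
have [J /minsetP[/asboolP gJ Jmin] _] := minset_exists gT.
have genD1 j : j \in J -> ~ exists2 c : 'I_t -> RR, forall i, 0 <= c i &
    real (u j) = \sum_(i in J | i != j) c i *: real (u i).
  move=> jJ [c c0 ujE].
  have : gens (J :\ j)%SET.
    apply/asboolP => y /gJ[c' c'0 ->].
    exists (fun i => c' j * c i + c' i) => [i|];
      first by rewrite addr_ge0 ?mulr_ge0.
    rewrite (bigD1 j) //= ujE scaler_sumr.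
    rewrite [RHS](eq_bigl (fun i => (i \in J) && (i != j))); last first.
      by move=> i; rewrite finset.in_setD1 andbC.
    by rewrite -big_split; apply: eq_bigr => i _ /=; rewrite scalerA -scalerDl.
  by move=> /Jmin /(_ (subD1set _ _)) JE; move: jJ;
    rewrite -JE finset.in_setD1 eqxx.
have u0 j : j \in J -> u j != 0.
  move=> jJ; apply/eqP => uj; apply: (genD1 j jJ); exists (fun=> 0) => //.
  by rewrite uj map_mx0 big1 // => i _; rewrite scale0r.
have face j : j \in J -> exists m : 'rV[RR]_d,
    [/\ forall i, i \in J -> 0 <= pairing m (real (u i)),
        pairing m (real (u j)) = 0
      & forall i, i \in J -> i != j -> 0 < pairing m (real (u i))].
  move=> jJ.
  have sep i : exists m : 'rV[RR]_d, i \in J -> i != j ->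
    [/\ forall i, i \in J -> 0 <= pairing m (real (u i)),
        pairing m (real (u j)) = 0 & 0 < pairing m (real (u i))].
    have [iJ|] := boolP ((i \in J) && (i != j)); last first.
      by move=> h; exists 0 => iJ ij; rewrite iJ ij in h.
    case/andP: iJ => iJ ij.
    (* The extra generator [- real (u j)] forces the functional to vanish on [u j]; being negative
       at [- real (u i)] makes it positive on [u i]. *)
    pose U (o : option 'I_t) : 'cV[RR]_d :=
      if o is Some l then (if l \in J then real (u l) else 0) else - real (u j).
    have [[c c0 uiE]|[m m0 mi]] := farkas U (- real (u i)); last first.
      exists m => _ _; split.
      - by move=> l lJ; have := m0 (Some l); rewrite /U lJ.
      - apply/eqP; rewrite eq_le; apply/andP; split.
          by have := m0 None; rewrite /U pairingNr oppr_ge0.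
        by have := m0 (Some j); rewrite /U jJ.
      - by move: mi; rewrite pairingNr oppr_lt0.
    (* The relation becomes lambda u_j = sum of c'_l u_l over l <> j in J, where c'_i >= 1. If
       lambda > 0, then u_j is redundant; otherwise the cone contains both c'_i u_i and its
       negative. *)
    exfalso; pose c' l := c (Some l) + (l == i)%:R.
    have c'0 l : 0 <= c' l by rewrite addr_ge0 // ler0n.
    have sO : \sum_o c o *: U o =
        \sum_(l in J) c (Some l) *: real (u l) - c None *: real (u j).
      rewrite (bigD1 (None : option 'I_t)) //= scalerN addrC; congr (_ - _).
      rewrite (reindex_omap Some id) /=; last by case.
      rewrite (eq_bigl xpredT) /=; last by move=> l; rewrite eqxx.
      rewrite (bigID (mem J)) /= [X in _ + X]big1 ?addr0.
        by apply: eq_bigr => l ->.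
      by move=> l /negPf->; rewrite scaler0.
    have sumE : (c None - c' j) *: real (u j) =
        \sum_(l in J | l != j) c' l *: real (u l).
      apply/eqP; rewrite scalerBl subr_eq addrC.
      rewrite -(bigD1 j (F := fun l => c' l *: real (u l)) jJ) /=; apply/eqP.
      under eq_bigr do rewrite scalerDl.
      rewrite big_split /= [X in _ = _ + X](bigD1 i) //= eqxx scale1r.
      rewrite [X in _ = _ + (_ + X)]big1 ?addr0; last first.
        by move=> l /andP[_ /negPf->]; rewrite scale0r.
      by apply/eqP; rewrite -subr_eq addrC uiE sO subrK.
    have [gt|le] := ltP 0 (c None - c' j).
      apply: (genD1 j jJ); exists (fun l => (c None - c' j)^-1 * c' l).
        by move=> l; rewrite mulr_ge0 // invr_ge0 ltW.
      under eq_bigr do rewrite -scalerA; rewrite -scaler_sumr -sumE scalerA.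
      by rewrite mulVf ?gt_eqF // scale1r.
    have : c' i *: real (u i) = 0.
      apply: sc; first by apply: cone_genZ => //; exact: cone_gen_mem.
      have -> : - (c' i *: real (u i)) = (c' j - c None) *: real (u j) +
          \sum_(l in J | (l != j) && (l != i)) c' l *: real (u l).
        move: sumE; rewrite (bigD1 i) /=; last by rewrite iJ.
        rewrite -[c' j - _]opprB scaleNr => ->.
        rewrite opprD -addrA -[LHS]addr0; congr (_ + _).
        rewrite addrC; apply/esym/eqP; rewrite subr_eq0; apply/eqP.
        by apply: eq_bigl => l; rewrite andbA.
      have -> : forall a b : 'cV[RR]_d, a + b = \sum_(o : bool) if o then a
        else b.
        by move=> a b; rewrite big_bool.
      apply: cone_gen_sum => -[] _.
        by apply: cone_genZ (cone_gen_mem _ _); rewrite -opprB oppr_ge0.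
      apply: cone_gen_sum => l _; exact: cone_genZ (cone_gen_mem _ _).
    move/eqP; rewrite scaler_eq0 real_eq0 (negPf (u0 i iJ)) orbF /c' eqxx.
    by rewrite gt_eqF // ltr_wpDl // ltr01.
  have [m mP] := choice sep.
  exists (\sum_(i in J | i != j) m i); split.
  - move=> i iJ; rewrite pairing_suml sumr_ge0 // => l /andP[lJ lj].
    by have [+ _ _] := mP l lJ lj; apply.
  - rewrite pairing_suml big1 // => l /andP[lJ lj].
    by have [_ + _] := mP l lJ lj; apply.
  - move=> i iJ ij; rewrite pairing_suml (bigD1 i) ?iJ //=.
    apply: ltr_pwDl; first by have [_ _ ->] := mP i iJ ij.
    apply: sumr_ge0 => l /andP[/andP[lJ lj] _].
    by have [+ _ _] := mP l lJ lj; apply.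
have inray j : j \in J -> exists i, ray (n i) (real (u j)).
  move=> jJ; have [v pv [c c0 ujE]] := primitive_multiple (u0 j jJ).
  have ujR : real (u j) = c%:R *: real v.
    by apply/matrixP => i l; rewrite ujE !mxE rmorphM.
  have : range n v.
    rewrite hn; split=> //; have [m [m0 mj mp]] := face j jJ.
    exists m.
      move=> y /gJ[c' c'0 ->]; rewrite pairing_sumr sumr_ge0 // => i iJ.
      by rewrite pairingZr mulr_ge0 // m0.
    have cR : (c%:R : RR) != 0 by rewrite pnatr_eq0 -lt0n.
    have vE : real v = c%:R^-1 *: real (u j) by rewrite ujR scalerA mulVf
      ?scale1r.
    rewrite predeqE => y; split=> [[a a0 ->]|[/gJ[c' c'0 ->]]].
      rewrite vE scalerA; split; last by rewrite pairingZr mj mulr0.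
      by apply: cone_genZ (cone_gen_mem _ _); rewrite mulr_ge0 ?invr_ge0 ?ler0n.
    rewrite pairing_sumr => /eqP; rewrite psumr_eq0 => [/allP mz|i iJ];
      last first.
      by rewrite pairingZr mulr_ge0 // m0.
    exists (c' j * c%:R); first by rewrite mulr_ge0 ?ler0n.
    rewrite (bigD1 j) //= big1 ?addr0 -?scalerA -?ujR // => i /andP[iJ ij].
    have := mz i (mem_index_enum _); rewrite iJ pairingZr mulf_eq0.
    by rewrite (gt_eqF (mp i iJ ij)) orbF => /eqP->; rewrite scale0r.
  move=> [i _ iv]; exists i; rewrite iv ujR; exists c%:R => //; exact: ler0n.
move=> /gJ[c c0 ->]; apply: cone_gen_sum => j jJ; apply: cone_genZ => //.
by have [i [a a0 ->]] := inray j jJ; apply: cone_genZ (cone_gen_mem _ _).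
Qed.

End Cone.

(** * Integral functionals attached to the rays of the cone *)

Section Facets.
Variables (RR : realType) (d : nat) (sigma : set 'cV[RR]_d).
Variables (s : nat) (n : 'I_s -> 'cV[int]_d).
Hypothesis hsigma : strongly_convex_rational_cone sigma.
Hypothesis hn_inj : injective n.
Hypothesis hn : range n = fan_rays (faces sigma).
Local Notation real := (map_mx (intr : int -> RR)).

Lemma ray_generator i : primitive (n i) /\ is_face sigma (ray (n i)).
Proof. by have : range n (n i) by [exists i]; rewrite hn. Qed.

Lemma dual_coneP m : dual_cone sigma m <-> forall i,
  0 <= pairing m (real (n i)).
Proof.
rewrite (cone_genP hsigma hn); split=> [h i|h x [c c0 ->]].
  exact/h/cone_gen_mem.
by rewrite pairing_sumr sumr_ge0 // => i _; rewrite pairingZr mulr_ge0.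
Qed.

Lemma dual_lattice_pointsP m :
  dual_lattice_points sigma m <-> forall i, 0 <= pairing m (n i).
Proof.
rewrite /dual_lattice_points /= dual_coneP.
by split=> h i; have := h i; rewrite pairing_intr ler0z.
Qed.

(** If no functional nonnegative on the cone were positive on [n i], then [- n i] would lie in
    sigma. Summing one such functional for each [i] gives a point interior to the dual cone. *)
Lemma interior_lattice_point : exists xi : 'rV[int]_d, forall i,
  0 < pairing xi (n i).
Proof.
have sep i : exists m : 'rV[int]_d,
    (forall j, 0 <= pairing m (n j)) /\ 0 < pairing m (n i).
  have [[c c0 niE]|[m m0 mi]] := farkas (fun j => real (n j)) (- real (n i)).
    have [/primitive_neq0 /negP[]] := ray_generator i.
    rewrite -(real_eq0 RR); apply/eqP; apply: (hsigma.2);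
      rewrite (cone_genP hsigma hn).
      exact: cone_gen_mem.
    by exists c.
  by apply: integral_functional m0 _; move: mi; rewrite pairingNr oppr_lt0.
have [m mP] := choice sep; exists (\sum_i m i) => i.
rewrite pairing_suml (bigD1 i) //= ltr_pwDl ?(mP i).2 //.
by apply: sumr_ge0 => j _; exact: (mP j).1.
Qed.

(** The face [ray (n i)] is cut out by a real functional, which is positive on each other [n j]
    because distinct primitive vectors span distinct rays. It is made integral for one [j] at a
    time, and the results are summed. *)
Lemma facet_functional i : exists f : 'rV[int]_d,
  pairing f (n i) = 0 /\ forall j, j != i -> 0 < pairing f (n j).
Proof.
have [pni [m m0 rE]] := ray_generator i.
have mi : pairing m (real (n i)) = 0.
  have : ray (n i) (real (n i)) by exists 1 => //; rewrite scale1r.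
  by rewrite rE => -[].
have mj j : j != i -> 0 < pairing m (real (n j)).
  move=> ji; rewrite lt_neqAle ((dual_coneP m).1 m0) andbT;
    apply/negP => /eqP mj.
  have : ray (n i) (real (n j)).
    by rewrite rE (cone_genP hsigma hn); split; first exact: cone_gen_mem.
  move=> [c c0 njE].
  (* Pairing n_j = c n_i with a Bezout vector of n_i shows that c is an integer, and with one of n_j
     that c is a unit; being nonnegative, c is 1. *)
  have [e eE] := primitive_bezout pni; have [e' e'E] :=
    primitive_bezout (ray_generator j).1.
  have pE x : (pairing x (n j))%:~R = c * (pairing x (n i))%:~R :> RR.
    by rewrite -!pairing_intr njE pairingZr.
  have cE := pE e; rewrite eE mulr1 in cE.
  have nE : n j = pairing e (n j) *: n i.
    apply/colP => l; have := pE (delta_mx 0 l).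
    by rewrite !pairing_delta_l mxE -cE -rmorphM /= => /intr_inj.
  have c1 : pairing e (n j) = 1.
    have := congr1 (pairing e') nE; rewrite e'E pairingZr => /esym h.
    have : pairing e (n j) \is a GRing.unit.
      by apply/unitrP; exists (pairing e' (n i)); rewrite mulrC h; split.
    move=> cU; have {}cU : (pairing e (n j) == 1) || (pairing e (n j) == -1) by
      [].
    have : 0 <= pairing e (n j) by rewrite -(ler0z RR) cE.
    by lia.
  by move/eqP: ji; apply; apply: hn_inj; rewrite nE c1 scale1r.
have sep j : exists m' : 'rV[int]_d, j != i ->
    [/\ forall l, 0 <= pairing m' (n l), pairing m' (n i) = 0
      & 0 < pairing m' (n j)].
  have [->|ji] := eqVneq j i; first by exists 0.
  have [||m' [m'0 m'j]] := @integral_functional RR d (option 'I_s)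
    (fun o => if o is Some l then n l else - n i) (n j) m.
  - case=> [l|]; first exact: (dual_coneP m).1.
    by rewrite map_mxN pairingNr mi oppr0.
  - exact: mj.
  exists m' => _; split=> // [l|]; first exact: (m'0 (Some l)).
  apply/eqP; rewrite eq_le (m'0 (Some i)) andbT.
  by have := m'0 None; rewrite pairingNr oppr_ge0.
have [m' mP] := choice sep; exists (\sum_(j | j != i) m' j); split.
  by rewrite pairing_suml big1 // => j /mP[].
move=> j ji; rewrite pairing_suml (bigD1 j) //=.
apply: ltr_pwDl; first by have [] := mP j ji.
by apply: sumr_ge0 => l /andP[/mP[+ _ _] _]; apply.
Qed.

(** A Bezout vector fixes the value on [n i], and a large multiple of the facet functional raises
    the other values. The value -1 will give lattice points just beyond a facet; the value r gives a
    monomial of the canonical power of least order along D_i. *)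
Lemma facet_shift i (c : int) (B : 'I_s -> int) : exists x : 'rV[int]_d,
  pairing x (n i) = c /\ forall j, j != i -> B j <= pairing x (n j).
Proof.
have [e eE] := primitive_bezout (ray_generator i).1.
have [f [fi fj]] := facet_functional i.
exists (c *: e + (\sum_j `|B j - c * pairing e (n j)|) *: f).
split=> [|j ji]; first by rewrite pairingDl !pairingZl eE fi mulr0 mulr1 addr0.
rewrite pairingDl !pairingZl (bigD1 j) //= mulrDl.
set S := \sum_(l < s | _) _; have S0 : 0 <= S by apply: sumr_ge0.
have := fj j ji; set y := pairing f _; set z := c * _ => y0; nia.
Qed.

End Facets.

(** * Interior points of convex hulls of lattice points *)

Lemma nbhs_rowP (RR : realType) d (y : 'rV[RR]_d) (U : set 'rV[RR]_d) :
  nbhs y U <-> exists2 e : RR, 0 < e &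
    forall x : 'rV[RR]_d, (forall j, `|y ord0 j - x ord0 j| < e) -> U x.
Proof.
rewrite nbhs_ballP; split=> -[e e0 yU]; exists e => // x.
  move=> h; apply: yU; split=> // i j; rewrite (ord1 i) /ball /=; exact: h.
by move=> [_ h]; apply: yU => j; exact: h.
Qed.

Section ConvexHull.
Variables (RR : realType) (d : nat).
Implicit Types (S : set 'rV[RR]_d) (x y : 'rV[RR]_d).

Lemma convex_hull_comb S (I : finType) (c : I -> RR) (x : I -> 'rV[RR]_d) :
  (forall i, 0 <= c i) -> \sum_i c i = 1 -> (forall i, S (x i)) ->
  convex_hull S (\sum_i c i *: x i).
Proof.
move=> c0 c1 Sx; exists #|I|, (c \o enum_val), (x \o enum_val).
split=> //=; first by rewrite -(big_enum_val c).
by rewrite -(big_enum_val (fun i => c i *: x i)).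
Qed.

Lemma sub_convex_hull S : S `<=` convex_hull S.
Proof.
move=> x Sx; rewrite -[x]scale1r.
have := @convex_hull_comb S 'I_1 (fun=> 1) (fun=> x) (fun=> ler01).
by rewrite !big_ord1; apply.
Qed.

Lemma convex_hull_convex S (I : finType) (c : I -> RR) (x : I -> 'rV[RR]_d) :
  (forall i, 0 <= c i) -> \sum_i c i = 1 -> (forall i, convex_hull S (x i)) ->
  convex_hull S (\sum_i c i *: x i).
Proof.
move=> c0 c1 Sx.
have /choice[f fP] : forall i, exists p : {t : nat & (('I_t ->
  RR) * ('I_t -> 'rV[RR]_d))%type},
    [/\ forall j, 0 <= (tagged p).1 j, \sum_j (tagged p).1 j = 1,
        forall j, S ((tagged p).2 j) & x i = \sum_j (tagged p).1 j *: (tagged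
          p).2 j].
  by move=> i; have [t [b [y [b0 b1 Sy xE]]]] := Sx i;
    exists (existT _ t (b, y)).
have -> : \sum_i c i *: x i = \sum_(q : {i : I & 'I_(tag (f i))})
    (c (tag q) * (tagged (f (tag q))).1 (tagged q)) *: (tagged (f (tag q))).2
      (tagged q).
  rewrite -(sig_big_dep xpredT (fun _ _ => true)
    (fun i j => (c i * (tagged (f i)).1 j) *: (tagged (f i)).2 j)) /=.
  apply: eq_bigr => i _; have [_ _ _ ->] := fP i; rewrite scaler_sumr.
  by apply: eq_bigr => j _; rewrite scalerA.
apply: convex_hull_comb.
- by move=> [i j] /=; rewrite mulr_ge0 //; have [] := fP i.
- rewrite -(sig_big_dep xpredT (fun _ _ => true)
    (fun i j => c i * (tagged (f i)).1 j)) /= -c1.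
  apply: eq_bigr => i _; rewrite -mulr_sumr.
  by have [_ -> _ _] := fP i; rewrite mulr1.
- by move=> [i j] /=; have [] := fP i.
Qed.

Lemma convex_hull_segment S (t : RR) x y : 0 <= t <= 1 ->
  convex_hull S x -> convex_hull S y -> convex_hull S ((1 - t) *: x + t *: y).
Proof.
move=> /andP[t0 t1] Px Py.
have := @convex_hull_convex S bool (fun b => if b then 1 - t else t)
  (fun b => if b then x else y).
rewrite !big_bool; apply; [|exact: subrK|by case].
by case; rewrite ?subr_ge0.
Qed.

End ConvexHull.

Section Interior.
Variables (RR : realType) (d s : nat) (n : 'I_s ->
  'cV[int]_d) (xi : 'rV[int]_d).
Hypothesis xiP : forall i, 0 < pairing xi (n i).
Variable A : set 'rV[int]_d.
Hypothesis A_ge0 : forall m, A m -> forall i, 0 <= pairing m (n i).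
Hypothesis A_add : forall m t, A m -> (forall i, 0 <= pairing t (n i)) ->
  A (m + t).
Variable m0 : 'rV[int]_d.
Hypothesis Am0 : A m0.
Local Notation real := (map_mx (intr : int -> RR)).
Let P : set 'rV[RR]_d := convex_hull [set real m | m in A].

Let P_mem m : A m -> P (real m).
Proof. by move=> Am; apply: sub_convex_hull; exists m. Qed.

(** Only integral translates are known to stay in [A], so the real multiple a t is interpolated
    between 0 and N t for an integer N > a. *)
Let P_ray x t (a : RR) : P x -> (forall i, 0 <= pairing t (n i)) -> 0 <= a ->
  P (x + a *: real t).
Proof.
move=> [l [c [y [c0 c1 Ay ->]]]] t0 a0.
have -> : \sum_i c i *: y i + a *: real t = \sum_i c i *: (y i + a *: real t).
  under [RHS]eq_bigr do rewrite scalerDr.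
  by rewrite big_split /= -scaler_suml c1 scale1r.
apply: convex_hull_convex => // i; have [m Am <-] := Ay i.
set N := (Num.truncn a).+1.
have aN : a < N%:R by exact: truncnS_gt.
have N0 : 0 < N%:R :> RR by rewrite ltr0n.
have -> : real m + a *: real t =
    (1 - a / N%:R) *: real m + (a / N%:R) *: real (m + t *+ N).
  have -> : real (m + t *+ N) = real m + N%:R *: real t.
    by apply/matrixP => u v; rewrite !mxE rmorphD /= mulmxnE rmorphMn /=
      mulr_natl.
  rewrite scalerBl scale1r scalerDr scalerA divfK ?gt_eqF //.
  by rewrite addrA subrK.
apply: convex_hull_segment; last 2 first.
- exact: P_mem.
- by apply/P_mem/A_add => // j; rewrite pairingMn mulrn_wge0.
by rewrite divr_ge0 ?ler0n //= ler_pdivrMr // mul1r ltW.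
Qed.

(* The shift by K xi absorbs the rounding of t to a lattice point. *)
Let P_cone : exists K : nat, forall x t, P x ->
  (forall i, 0 <= pairing t (real (n i))) -> P (x + (t + K%:R *: real xi)).
Proof.
(* [M] bounds the sum of the absolute entries of each [n i]. One summand M xi returns the integral
   part of [t] to the dual cone, and one more for each of the [d] fractional directions does the
   same there. *)
pose M := (\sum_i \sum_j `|n i j 0%R|)%N; exists (M + d * M)%N => x t Px t0.
have nM i j : (`|n i j ord0| <= M)%N.
  by rewrite /M (bigD1 i) //= (bigD1 j) //= -addnA leq_addr.
pose fl : 'rV[int]_d := \row_j Num.floor (t ord0 j).
pose th j : RR := t ord0 j - (Num.floor (t ord0 j))%:~R.
have th0 j : 0 <= th j by rewrite subr_ge0 floor_le.
have th1 j : th j <= 1.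
  by rewrite lerBlDr addrC ltW // -[1]/(1%:~R : RR) -intrD floorD1_gt.
have tE : t = real fl + \sum_j th j *: delta_mx 0 j.
  apply/rowP => j; rewrite mxE summxE (bigD1 j) //= big1 ?addr0.
    by rewrite !mxE !eqxx mulr1 addrC subrK.
  by move=> i ij; rewrite !mxE (eq_sym j) (negPf ij) andbF mulr0.
pose a : 'rV[int]_d := fl + M%:Z *: xi.
pose b (j : 'I_d) : 'rV[int]_d := delta_mx 0 j + M%:Z *: xi.
have -> : t + (M + d * M)%:R *: real xi =
    real a + \sum_j (th j *: real (b j) + ((1 - th j) * M%:R) *: real xi).
  have bE j : th j *: real (b j) + ((1 - th j) * M%:R) *: real xi =
      th j *: delta_mx 0 j + M%:R *: real xi.
    apply/matrixP => u v; rewrite !mxE rmorphD rmorphM /= -pmulrn.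
    have -> : (((u == 0) && (v == j))%:R)%:~R = ((u == 0) && (v == j))%:R :> RR.
      by case: (_ && _).
    ring.
  under eq_bigr do rewrite bE.
  rewrite big_split /= sumr_const card_ord.
  have -> : real a = real fl + M%:R *: real xi.
    by apply/matrixP => u v; rewrite !mxE rmorphD rmorphM /= -pmulrn.
  rewrite {1}tE natrD natrM scalerDl -scalerA -[(_ *: real xi) *+ d]scaler_nat.
  by rewrite -!addrA; congr (_ + _); rewrite addrCA.
have a0 i : 0 <= pairing a (n i).
  rewrite -(ler0z RR) -pairing_intr.
  have -> : real a = t - \sum_j th j *: delta_mx 0 j + M%:R *: real xi.
    by rewrite {1}tE addrK; apply/matrixP => u v;
      rewrite !mxE rmorphD rmorphM /= -pmulrn.
  rewrite pairingDl pairingBl pairingZl pairing_suml.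
  rewrite (pairing_intr _ xi).
  have : \sum_j pairing (th j *: delta_mx 0 j) (real (n i)) <= M%:R.
    apply: (@le_trans _ _ ((\sum_j `|n i j 0%R|)%N)%:R); last first.
      by rewrite ler_nat /M (bigD1 i) //= leq_addr.
    rewrite natr_sum; apply: ler_sum => j _.
    rewrite pairingZl pairing_delta_l mxE -[_%:R]/((`|n i j ord0|%N%:Z)%:~R :
      RR).
    rewrite abszE intr_norm.
    apply: (le_trans (ler_norm _)); rewrite normrM (ger0_norm (th0 j)).
    by rewrite ler_piMl.
  have xi1 : 1 <= (pairing xi (n i))%:~R :> RR.
    by rewrite -[1]/(1%:~R) ler_int; exact: xiP.
  move=> h; rewrite addrAC -addrA addr_ge0 // ?subr_ge0.
  by apply: le_trans h _; rewrite ler_peMr.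
have b0 j i : 0 <= pairing (b j) (n i).
  rewrite pairingDl pairingZl pairing_delta_l.
  have h1 : - M%:Z <= n i j ord0 by have := nM i j; lia.
  have h2 : M%:Z <= M%:Z * pairing xi (n i) by rewrite ler_peMr //; exact: xiP.
  by rewrite -(subrr M%:Z) [M%:Z - _]addrC; apply: lerD.
rewrite addrA -[real a]scale1r.
have : P (x + 1 *: real a) by exact: P_ray.
elim/big_rec: _ (x + _) => [y Py|j z _ IH y Py]; first by rewrite addr0.
rewrite addrA; apply: IH; rewrite addrA; apply: P_ray.
- by apply: P_ray.
- by move=> i; exact/ltW/xiP.
- by rewrite mulr_ge0 // subr_ge0.
Qed.

(** Since the interior is relative, y - a xi has to be placed in the affine hull: it is the affine
    combination y + a m0 - a (m0 + xi) of points of [P]. The norm [N] of xi keeps it within the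
    given neighbourhood. *)
Lemma interior_shift y : relative_interior P y ->
  exists2 a : RR, 0 < a & P (y - a *: real xi).
Proof.
move=> [Py [U /nbhs_rowP[e e0 yU] UP]].
pose N := 1 + \sum_j `|(xi ord0 j)%:~R : RR|.
have N0 : 0 < N by rewrite ltr_pwDl ?ltr01 // sumr_ge0.
exists (e / N); first exact: divr_gt0.
apply: UP; split.
  apply: yU => j; rewrite !mxE subKr.
  rewrite normrM gtr0_norm ?divr_gt0 // mulrAC ltr_pdivrMr // ltr_pM2l //.
  rewrite /N (bigD1 j) //= addrCA ltrDl ltr_pwDl ?ltr01 // sumr_ge0 //.
exists 3%N, (fun i => tnth [tuple 1; e / N; - (e / N)] i),
  (fun i => tnth [tuple y; real m0; real (m0 + xi)] i).
have Px : P (real (m0 + xi)) by apply/P_mem/A_add => // i; exact/ltW/xiP.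
split.
- by rewrite !big_ord_recl big_ord0 /= !tnth0 !(tnth_nth 0) /= addr0 subrr
    addr0.
- by move=> i; rewrite (tnth_nth 0); case: i => -[|[|[|//]]] //= _;
    exact: P_mem.
- rewrite !big_ord_recl big_ord0 !(tnth_nth 0) /= addr0 scale1r.
  rewrite map_mxD scalerDr !scaleNr.
  by rewrite [X in _ = y + X]addrA subrr sub0r.
Qed.

(** As xi is strictly positive on nonzero vectors of the cone, the point y - a xi of the hull has a
    smaller value than y; hence some exponent entering it does as well. *)
Lemma interior_support y (c : 'I_s -> RR) : relative_interior P y ->
  (forall i, 0 <= c i) -> \sum_i c i *: real (n i) != 0 ->
  exists2 m, A m & pairing (real m) (\sum_i c i *: real (n i)) <
    pairing y (\sum_i c i *: real (n i)).
Proof.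
move=> /interior_shift[a a0 [l [b [x [b0 b1 Ax xE]]]]] c0.
set v := \sum_i _ => v0; apply: contrapT => nA.
have {}nA m : A m -> pairing y v <= pairing (real m) v.
  by move=> Am; rewrite leNgt; apply/negP => h; apply: nA; exists m.
have xiv : 0 < pairing (real xi) v.
  have xin i : 0 < pairing (real xi) (real (n i)).
    by rewrite pairing_intr ltr0z.
  rewrite pairing_sumr; have t0 i : true -> 0 <= pairing (real xi) (c i *: real
    (n i)).
    by move=> _; rewrite pairingZr mulr_ge0 // ltW.
  rewrite lt_neqAle sumr_ge0 // andbT eq_sym psumr_eq0 //.
  apply: contra v0 => /allP cz; apply/eqP; rewrite /v big1 // => i _.
  have := cz i (mem_index_enum _); rewrite pairingZr mulf_eq0 (gt_eqF (xin i)).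
  by rewrite orbF => /eqP->; rewrite scale0r.
have : pairing y v <= pairing (y - a *: real xi) v.
  rewrite xE pairing_suml -[leLHS]mul1r -b1 mulr_suml.
  apply: ler_sum => i _; rewrite pairingZl ler_wpM2l //.
  by have [m Am <-] := Ax i; exact: nA.
by rewrite pairingBl pairingZl leNgt ltrBlDr ltrDl mulr_gt0.
Qed.

(** Every vector is a nonnegative combination of the f_l - y plus a vector of the dual cone
    ([decomp]). As [P] is nearly stable under the dual cone, this lets one move from [y] a little in
    every direction without leaving [P]. *)
Lemma support_interior y :
  (forall c : 'I_s -> RR, (forall i, 0 <= c i) ->
    \sum_i c i *: real (n i) != 0 ->
    exists2 m, A m & pairing (real m) (\sum_i c i *: real (n i)) <
      pairing y (\sum_i c i *: real (n i))) ->
  relative_interior P y.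
Proof.
move=> hy; have [F [FA FP]] := dickson (fun m i => `|pairing m (n i)|%N) A.
pose f (l : 'I_(size F)) := tnth (in_tuple F) l.
have Af l : A (f l) by apply/FA/mem_tnth.
have decomp z : exists c : 'I_(size F) -> RR, exists t,
    [/\ forall l, 0 <= c l, forall i, 0 <= pairing t (real (n i))
      & z = \sum_l c l *: real (f l) - (\sum_l c l) *: y + t].
  pose g (x : 'rV[RR]_d) : 'cV[RR]_s := \col_i pairing x (real (n i)).
  have gP (b : 'rV[RR]_s) x :
      pairing b (g x) = pairing x (\sum_i b ord0 i *: real (n i)).
    rewrite pairing_sumr pairingE; apply: eq_bigr => i _.
    by rewrite mxE pairingZr.
  (* Farkas is applied to the vectors of values on the [n i]. The unit vectors stand for the
     remainder in the dual cone, and in the alternative they make the entries of [b] nonnegative, so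
     that [b] yields a vector of the cone. *)
  have [[c c0 zE]|[b b0 bz]] := farkas (fun o : ('I_(size F) + 'I_s)%type =>
      match o with inl l => g (real (f l) - y) | inr i =>
        delta_mx i 0 end) (g z).
    exists (c \o inl), (z - \sum_l c (inl l) *: (real (f l) - y)); split=> //.
    - by move=> l /=.
    - move=> i; have := congr1 (fun x : 'cV[RR]_s => x i 0) zE.
      rewrite big_sumType /= mxE [RHS]mxE !summxE => ziE.
      rewrite pairingBl ziE pairing_suml.
      under eq_bigr do rewrite mxE [X in _ * X]mxE -pairingZl.
      rewrite addrAC subrr add0r (bigD1 i) //= big1 ?addr0.
        by rewrite !mxE !eqxx mulr1.
      by move=> j ji; rewrite !mxE (eq_sym i) (negPf ji) mulr0.
    - under [X in _ = _ + (_ - X)]eq_bigr do rewrite scalerBr.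
      by rewrite sumrB -scaler_suml addrC subrK.
  exfalso; have c0 i : 0 <= b ord0 i by have := b0 (inr i);
    rewrite pairing_delta_r.
  rewrite gP in bz.
  have [|m Am mlt] := hy (fun i => b ord0 i) c0.
    by apply: contraTneq bz => ->; rewrite pairing0r ltxx.
  (* An element of the finite set is at most [m] on each [n i], hence also on the separating
     vector. *)
  have [m' m'F m'le] := FP m Am.
  have [l lE] : exists l, f l = m'.
    by have /tnthP[l ->] : m' \in in_tuple F by []; exists l.
  have := b0 (inl l); rewrite gP pairingBl lE subr_ge0 leNgt => /negP; apply.
  apply: le_lt_trans mlt; rewrite !pairing_sumr; apply: ler_sum => i _.
  rewrite !pairingZr ler_wpM2l // !pairing_intr.
  rewrite ler_int; have := m'le i; have := A_ge0 Am i;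
    have := A_ge0 (FA _ m'F) i; lia.
have [K PK] := P_cone.
have comb x (c : 'I_(size F) -> RR) t : P x -> (forall l, 0 <= c l) ->
    (forall i, 0 <= pairing t (real (n i))) ->
    P ((1 + \sum_l c l)^-1 *: (x + \sum_l c l *: real (f l) + (t + K%:R *: real
      xi))).
  move=> Px c0 t0; set C := 1 + _.
  have C1 : 1 <= C by rewrite lerDl sumr_ge0.
  have C0 : 0 < C by apply: lt_le_trans C1.
  have Pc : P (C^-1 *: (x + \sum_l c l *: real (f l))).
    rewrite scalerDr scaler_sumr.
    have := @convex_hull_convex RR d [set real m | m in A] (option 'I_(size F))
      (fun o => if o is Some l then C^-1 * c l else C^-1)
      (fun o => if o is Some l then real (f l) else x).
    have bigO (V : nmodType) (h : option 'I_(size F) -> V) :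
        \sum_o h o = h None + \sum_l h (Some l).
      rewrite (bigD1 None) //= (reindex_omap Some id) /=; last by case.
      by congr (_ + _); apply: eq_bigl => l; rewrite eqxx.
    rewrite !bigO /=; under [in X in _ -> _ -> _ ->
      X]eq_bigr do rewrite -scalerA.
    apply.
    - by case=> [l|]; rewrite ?mulr_ge0 ?invr_ge0 // ltW.
    - by rewrite -mulr_sumr -[X in X + _]mulr1 -mulrDr mulVf ?gt_eqF.
    - by case=> [l|//]; exact: P_mem.
  have := PK _ t Pc t0 => Pt.
  have := @convex_hull_segment _ _ _ C^-1 _ _ _ Pc Pt.
  rewrite scalerBl scale1r [in C^-1 *: (_ + (_ + _))]scalerDr addrA subrK
    -scalerDr.
  by apply; rewrite invr_ge0 ltW //= invf_le1.
have Py : P y.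
  (* The shift by K xi that [comb] adds is subtracted in advance; the vector is chosen so that the
     sum in [comb], started at [m0], equals C y. *)
  have [c [t [c0 t0 zE]]] := decomp (y - real m0 - K%:R *: real xi).
  have := comb _ c t (P_mem Am0) c0 t0.
  set C := 1 + _; have C0 : 0 < C by rewrite ltr_pwDl ?ltr01 ?sumr_ge0.
  have -> : real m0 + \sum_l c l *: real (f l) + (t + K%:R *: real xi) = C *: y.
    by apply/rowP => j; have /rowP/(_ j) := zE; rewrite !mxE /C; lra.
  by rewrite scalerA mulVf ?scale1r ?gt_eqF.
have move_any z : exists2 a, 0 < a <= 1 & P (y + a *: z).
  have [c [t [c0 t0 zE]]] := decomp (z - K%:R *: real xi).
  have := comb _ c t Py c0 t0.
  set C := 1 + _; have C1 : 1 <= C by rewrite lerDl sumr_ge0.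
  have C0 : 0 < C by apply: lt_le_trans C1.
  have -> : y + \sum_l c l *: real (f l) + (t + K%:R *: real xi) = C *: y + z.
    by apply/rowP => j; have /rowP/(_ j) := zE; rewrite !mxE /C; lra.
  rewrite scalerDr scalerA mulVf ?scale1r ?gt_eqF // => h.
  by exists C^-1 => //; rewrite invr_gt0 C0 invf_le1.
have [e eP] := choice (fun p : bool * 'I_d => 
  let: ex_intro2 a a0 Pa := move_any ((if p.1 then 1 else -1) *: delta_mx 0
    p.2) in
  ex_intro (fun a => 0 < a <= 1 /\ P (y + a *: ((if p.1 then 1 else -1) *:
    delta_mx 0 p.2))) a (conj a0 Pa)).
(* All factors lie in ]0, 1], so the product is a positive lower bound of all of them. *)
pose e0 := \prod_p e p.
have e00 : 0 < e0 by apply: prodr_gt0 => p _; have [/andP[]] := eP p.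
have e0le p : e0 <= e p.
  rewrite /e0 (bigD1 p) //= ger_pMr; last by have [/andP[]] := eP p.
  by apply: prodr_ile1 => q _; have [/andP[/ltW-> ->]] := eP q.
have Pj j b : `|b| <= e0 -> P (y + b *: delta_mx 0 j).
  move=> be; set p := (0 <= b, j).
  have [/andP[ep0 ep1] Pp] := eP p.
  have := @convex_hull_segment _ _ _ (`|b| / e p) _ _ _ Py Pp.
  have -> : (1 - `|b| / e p) *: y + (`|b| / e p) *:
      (y + e p *: ((if p.1 then 1 else -1) *: delta_mx 0 p.2)) = y + b *:
        delta_mx 0 j.
    rewrite scalerBl scale1r scalerDr addrA subrK !scalerA divfK ?gt_eqF //.
    congr (_ + _ *: _); rewrite /p /=; case: ifP => b0.
      by rewrite mulr1 ger0_norm.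
    by rewrite mulrN1 ltr0_norm ?opprK // ltNge b0.
  apply; rewrite divr_ge0 ?normr_ge0 ?(ltW ep0) //= ler_pdivrMr // mul1r.
  exact: le_trans be (e0le p).
split=> //; exists P; last by move=> x [].
(* [x] is the average of the d + 1 points y and y + (d + 1) (x_j - y_j) delta_j, so each
   displacement along an axis is d + 1 times larger than that of [x]. *)
apply/nbhs_rowP; exists (e0 / d.+1%:R); first by rewrite divr_gt0 // ltr0n.
move=> x xP.
have := @convex_hull_convex RR d [set real m | m in A] 'I_d.+1
  (fun=> d.+1%:R^-1)
  (fun o => if unlift ord0 o is Some j then
     y + (d.+1%:R * (x ord0 j - y ord0 j)) *: delta_mx 0 j else y).
have -> : \sum_(i < d.+1) d.+1%:R^-1 *: (if unlift ord0 i is Some j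
   then y + (d.+1%:R * (x ord0 j - y ord0 j)) *: delta_mx 0 j else y) = x.
  rewrite -scaler_sumr big_ord_recl unlift_none.
  under eq_bigr do rewrite liftK.
  rewrite big_split /= sumr_const card_ord addrA -mulrS.
  apply/rowP => j; rewrite mxE [(_ + _ : 'rV_d) _ _]mxE summxE (bigD1 j) //=
    big1.
    rewrite addr0 !mxE !eqxx mulr1 mulmxnE -[y _ _ *+ _]mulr_natl -mulrDr
      (addrC (y _ _)) subrK.
    by rewrite mulrA mulVf ?mul1r // pnatr_eq0.
  by move=> i ij; rewrite !mxE (eq_sym j) (negPf ij) andbF mulr0.
apply.
- by move=> _; rewrite invr_ge0 ler0n.
- by rewrite sumr_const card_ord -[_ *+ _]mulr_natr mulVf // pnatr_eq0.
- move=> i; case: unliftP => [j _|//]; apply: Pj.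
  rewrite normrM normr_nat distrC mulrC -ler_pdivlMr ?ltr0n //; exact: ltW.
Qed.

End Interior.

(** * Laurent polynomials *)

Section Laurent.
Variables (k : fieldType) (d : nat).
Local Notation K := (ratfun k d).
Implicit Types (m u : 'rV[int]_d) (f g : K) (S : set 'rV[int]_d).
Local Notation mon := (monomial k).

Definition cst (c : k) : K := tofrac (mpolyC d c).

Lemma cst_is_zmod_morphism : zmod_morphism cst.
Proof. by move=> a b; rewrite /cst mpolyCB tofracB. Qed.

Lemma cst_is_monoid_morphism : monoid_morphism cst.
Proof. by split=> [|a b]; rewrite /cst ?mpolyC1 ?tofrac1 // mpolyCM tofracM.
  Qed.

HB.instance Definition _ := GRing.isZmodMorphism.Build k K cst
  cst_is_zmod_morphism.
HB.instance Definition _ := GRing.isMonoidMorphism.Build k K cst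
  cst_is_monoid_morphism.

Lemma tofracX_neq0 (i : 'I_d) : (tofrac (mpolyX k (mnm1 i)) : K) != 0.
Proof.
rewrite tofrac_eq0; apply/eqP => /(congr1 (mcoeff (mnm1 i))).
by rewrite mcoeffX eqxx mcoeff0 => /eqP; rewrite oner_eq0.
Qed.

Lemma monomialD m u : mon (m + u) = mon m * mon u.
Proof.
rewrite /monomial -big_split; apply: eq_bigr => i _ /=.
by rewrite mxE expfzDr // tofracX_neq0.
Qed.

Lemma monomial0 : mon (0 : 'rV[int]_d) = 1.
Proof. by rewrite /monomial big1 // => i _; rewrite mxE expr0z. Qed.

Lemma monomial_neq0 m : mon m != 0.
Proof.
by apply/prodf_neq0 => i _; rewrite expfz_neq0 // tofracX_neq0.
Qed.

Lemma monomialB m u : mon (m - u) = mon m / mon u.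
Proof.
by apply: (canRL (mulfK (monomial_neq0 u))); rewrite -monomialD subrK.
Qed.

Lemma monomialN m : mon (- m) = (mon m)^-1.
Proof. by rewrite -[- m]add0r monomialB monomial0 div1r. Qed.

Lemma monomialMn m q : mon (m *+ q) = mon m ^+ q.
Proof.
by elim: q => [|q IH]; rewrite ?monomial0 // mulrS monomialD IH exprS.
Qed.

Lemma monomial_sum (I : Type) (r : seq I) (P : pred I) (x : I -> 'rV[int]_d) :
  mon (\sum_(i <- r | P i) x i) = \prod_(i <- r | P i) mon (x i).
Proof. exact: (big_morph _ monomialD monomial0). Qed.

Lemma monomial_nonneg m : (forall i, 0 <= m ord0 i) ->
  mon m = tofrac (mpolyX k (Multinom [tuple `|m ord0 i|%N | i < d])).
Proof.
move=> m0; rewrite mpolyXE_id rmorph_prod; apply: eq_bigr => i _ /=.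
by rewrite mnmE rmorphXn /= -[in LHS](gez0_abs (m0 i)).
Qed.

(** Multiplying by a monomial with large exponents moves the relation into the polynomial ring,
    where distinct monomials are independent. *)
Lemma monomials_free (s : seq 'rV[int]_d) (c : 'rV[int]_d -> k) : uniq s ->
  \sum_(m <- s) cst (c m) * mon m = 0 -> forall m, m \in s -> c m = 0.
Proof.
move=> us s0 m1 m1s.
pose N := (\sum_(m <- s) \sum_i `|m ord0 i|)%N.
pose sh : 'rV[int]_d := const_mx N%:Z.
have shP m : m \in s -> forall i, 0 <= (m + sh) ord0 i.
  move=> ms i; have mN : (`|m ord0 i| <= N)%N.
    by rewrite /N (big_rem m) //= (bigD1 i) //= -addnA leq_addr.
  have : - N%:Z <= m ord0 i by lia.
  by rewrite !mxE -[X in X <= _]sub0r lerBlDr.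
pose e m : multinom d := Multinom [tuple `|((m + sh)%R ord0 i)|%N | i < d].
have eI m : m \in s -> (e m == e m1) = (m == m1).
  move=> ms; apply/eqP/eqP => [/mnmP h|->//]; apply/rowP => i.
  change (m ord0 i = m1 ord0 i).
  have := h i; rewrite !mnmE => /(congr1 Posz).
  rewrite !gez0_abs ?shP // !mxE; exact: addIr.
have : \sum_(m <- s) mpolyC d (c m) * mpolyX k (e m) = 0.
  apply/eqP; rewrite -tofrac_eq0 rmorph_sum /=; apply/eqP.
  transitivity ((\sum_(m <- s) cst (c m) * mon m) * mon sh);
    last by rewrite s0 mul0r.
  rewrite mulr_suml [RHS]big_seq [LHS]big_seq; apply: eq_bigr => m ms.
  by rewrite rmorphM /= -mulrA -monomialD monomial_nonneg //; exact: shP.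
move=> /(congr1 (mcoeff (e m1))); rewrite mcoeff0 raddf_sum /= => <-.
rewrite (bigD1_seq m1) //= mcoeffCM mcoeffX eqxx mulr1 big_seq_cond big1 ?addr0
  //.
by move=> m /andP[ms mm1]; rewrite mcoeffCM mcoeffX eI // (negPf mm1) mulr0.
Qed.

(** Laurent polynomials are only a subset of the function field, so coefficients are first a
    relation. The list may contain exponents with coefficient 0, which allows two elements to share
    one list. *)
Definition has_coef f (c : 'rV[int]_d -> k) : Prop := exists s : seq 'rV[int]_d,
  [/\ uniq s, forall m, m \notin s -> c m = 0 & f = \sum_(m <- s) cst (c m) *
    mon m].

Lemma has_coef_widen f c (s : seq 'rV[int]_d) : has_coef f c ->
  exists2 s', {subset s <= s'} & [/\ uniq s', forall m, m \notin s' -> c m = 0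
    & f = \sum_(m <- s') cst (c m) * mon m].
Proof.
move=> [s0 [us0 c0 fE]]; exists (s0 ++ undup [seq m <- s | m \notin s0]).
  move=> m ms; rewrite mem_cat mem_undup mem_filter ms andbT; exact: orbN.
split.
- rewrite cat_uniq us0 undup_uniq andbT; apply/hasPn => m.
  by rewrite mem_undup mem_filter => /andP[].
- by move=> m; rewrite mem_cat negb_or => /andP[/c0].
- rewrite big_cat /= -fE big_seq big1 ?addr0 // => m.
  by rewrite mem_undup mem_filter => /andP[/c0-> _]; rewrite rmorph0 mul0r.
Qed.

Lemma has_coef_common f c g c' : has_coef f c -> has_coef g c' ->
  exists s, [/\ uniq s, forall m, m \notin s -> c m = 0 /\ c' m = 0,
    f = \sum_(m <- s) cst (c m) * mon m & g = \sum_(m <- s) cst (c' m) * mon m].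
Proof.
move=> [s [us c0 fE]] /(has_coef_widen s)[s' ss' [us' c'0 gE]].
exists s'; split=> //.
  by move=> m ms'; rewrite c'0 // c0 //; apply: contra ms' => /ss'.
rewrite fE [RHS](bigID (mem s)) /= [X in _ + X]big1 ?addr0; last first.
  by move=> m /c0->; rewrite rmorph0 mul0r.
rewrite -[RHS]big_filter; apply: perm_big; apply: uniq_perm;
  rewrite ?filter_uniq //.
by move=> m; rewrite mem_filter; case ms: (m \in s) => //=; rewrite ss'.
Qed.

Lemma has_coef_uniq f c c' : has_coef f c -> has_coef f c' -> c = c'.
Proof.
move=> h h'; have [s [us z -> e]] := has_coef_common h h'; apply/funext => m.
have [ms|/z[-> ->]//] := boolP (m \in s); apply/eqP; rewrite -subr_eq0;
  apply/eqP.
apply: (monomials_free us (c := fun m => c m - c' m)) ms.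
under eq_bigr do rewrite rmorphB mulrBl.
by rewrite sumrB e subrr.
Qed.

Lemma has_coef0 : has_coef 0 (fun=> 0).
Proof. by exists [::]; split=> //; rewrite big_nil. Qed.

Lemma has_coefD f c g c' : has_coef f c -> has_coef g c' ->
  has_coef (f + g) (fun m => c m + c' m).
Proof.
move=> h h'; have [s [us z -> ->]] := has_coef_common h h'.
exists s; split=> // [m /z[-> ->]|]; first exact: addr0.
by rewrite -big_split; apply: eq_bigr => m _; rewrite rmorphD mulrDl.
Qed.

Lemma has_coef_term a m : has_coef (cst a * mon m) (fun m' => a *+ (m' == m)).
Proof.
exists [:: m]; split=> // [m'|]; last by rewrite big_seq1 eqxx.
by rewrite inE => /negPf->.
Qed.

Lemma span_ind S (Q : K -> Prop) : Q 0 -> (forall f g, Q f -> Q g ->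
  Q (f + g)) ->
  (forall a m, S m -> Q (cst a * mon m)) -> forall f, monomial_span S f -> Q f.
Proof.
move=> Q0 QD Qt f [t [c [m [Sm ->]]]].
by apply: big_ind => // i _; apply: Qt.
Qed.

Lemma span_has_coef S f : monomial_span S f <->
  exists2 c, has_coef f c & forall m, c m != 0 -> S m.
Proof.
split.
  elim/span_ind: f / => [|f g [c fc cS] [c' gc c'S]|a m Sm].
  - by exists (fun=> 0); [exact: has_coef0|move=> m; rewrite eqxx].
  - exists (fun m => c m + c' m); first exact: has_coefD.
    move=> m; have [c0|/cS //] := eqVneq (c m) 0.
    by rewrite c0 add0r => /c'S.
  - exists (fun m' => a *+ (m' == m)); first exact: has_coef_term.
    by move=> m'; have [->|] := eqVneq m' m; rewrite ?eqxx.
move=> [c [s [us c0 ->]] cS].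
pose s' := [seq m <- s | c m != 0].
exists (size s'), (fun i => c (tnth (in_tuple s') i)), (tnth (in_tuple s')).
split.
  by move=> i; apply: cS; have := mem_tnth i (in_tuple s');
    rewrite mem_filter => /andP[].
rewrite -(big_tuple _ _ (in_tuple s') xpredT (fun m => cst (c m) * mon m)) /=.
rewrite big_filter (bigID (fun m => c m == 0)) /= big1 ?add0r //.
by move=> m /eqP->; rewrite rmorph0 mul0r.
Qed.

Lemma span0 S : monomial_span S (0 : K).
Proof. by apply/span_has_coef; exists (fun=> 0); [exact: has_coef0|move=> m;
  rewrite eqxx]. Qed.

Lemma spanD S f g : monomial_span S f -> monomial_span S g ->
  monomial_span S (f + g).
Proof.
move=> /span_has_coef[c fc cS] /span_has_coef[c' gc c'S]; apply/span_has_coef.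
exists (fun m => c m + c' m); first exact: has_coefD.
by move=> m; have [->|/cS //] := eqVneq (c m) 0; rewrite add0r => /c'S.
Qed.

Lemma span_term S a m : S m -> monomial_span S (cst a * mon m).
Proof.
move=> Sm; apply/span_has_coef; exists (fun m' => a *+ (m' == m)).
  exact: has_coef_term.
by move=> m'; have [->|] := eqVneq m' m; rewrite ?eqxx.
Qed.

Lemma span_monomial S m : S m -> monomial_span S (mon m).
Proof. by move=> Sm; rewrite -[mon m]mul1r -(rmorph1 cst);
  exact: span_term. Qed.

Lemma sub_span S S' : S `<=` S' -> monomial_span S `<=` (monomial_span S' : set
  K).
Proof.
move=> SS' f; elim/span_ind: f / => [|f g|a m /SS']; first exact: span0.
  exact: spanD.
exact: span_term.
Qed.

Lemma spanM S S' S'' f g : (forall m u, S m -> S' u -> S'' (m + u)) ->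
  monomial_span S f -> monomial_span S' g -> monomial_span S'' (f * g).
Proof.
move=> SS Sf; elim/span_ind: g / => [|g h|b u S'u].
- by rewrite mulr0; exact: span0.
- by rewrite mulrDr; exact: spanD.
elim/span_ind: f / Sf => [|f g|a m Sm].
- by rewrite mul0r; exact: span0.
- by rewrite mulrDl; exact: spanD.
by rewrite mulrACA -rmorphM -monomialD; apply/span_term/SS.
Qed.

Lemma spanZ S a f : monomial_span S f -> monomial_span S (cst a * f).
Proof.
move=> Sf; apply: (@spanM [set 0] S) => //; last first.
  by rewrite -[cst a]mulr1 -monomial0; exact: span_term.
by move=> m u /= ->; rewrite add0r.
Qed.

Lemma span_sum S (I : Type) (r : seq I) (P : pred I) (F : I -> K) :
  (forall i, P i -> monomial_span S (F i)) ->
  monomial_span S (\sum_(i <- r | P i) F i).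
Proof. by move=> h; apply: big_ind => //; [exact: span0|exact: spanD]. Qed.

Definition laurent f := monomial_span [set: 'rV[int]_d] f.

(** Outside the Laurent polynomials this is the zero function; hence the hypotheses [laurent]
    below. *)
Definition coef f : 'rV[int]_d -> k := xget (fun=> 0) (has_coef f).

Lemma span_laurent S f : monomial_span S f -> laurent f.
Proof. exact: sub_span. Qed.

Lemma laurentM f g : laurent f -> laurent g -> laurent (f * g).
Proof. exact: spanM. Qed.

Lemma has_coef_coef f c : has_coef f c -> coef f = c.
Proof.
by move=> h; rewrite /coef; case: xgetP => [c' -> h'|/(_ c)//];
  exact: has_coef_uniq h' h.
Qed.

Lemma laurent_has_coef f : laurent f -> has_coef f (coef f).
Proof. by move=> /span_has_coef[c fc _]; rewrite (has_coef_coef fc). Qed.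

Lemma spanP S f : monomial_span S f <->
  laurent f /\ forall m, coef f m != 0 -> S m.
Proof.
split=> [Sf|[/laurent_has_coef fc fS]]; last by apply/span_has_coef;
  exists (coef f).
split; first exact: span_laurent Sf.
by have /span_has_coef[c fc cS] := Sf; rewrite (has_coef_coef fc).
Qed.

Lemma coef0 m : coef 0 m = 0.
Proof. by rewrite (has_coef_coef has_coef0). Qed.

Lemma coefD f g m : laurent f -> laurent g -> coef (f + g) m = coef f m + coef
  g m.
Proof.
by move=> /laurent_has_coef h /laurent_has_coef h';
  rewrite (has_coef_coef (has_coefD h h')).
Qed.

Lemma coef_term a m m' : coef (cst a * mon m) m' = a *+ (m' == m).
Proof. by rewrite (has_coef_coef (has_coef_term a m)). Qed.

Lemma coef_monomial m m' : coef (mon m) m' = (m' == m)%:R.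
Proof. by rewrite -[mon m]mul1r -(rmorph1 cst) coef_term. Qed.

Lemma coef_monomialM u f m : laurent f -> coef (mon u * f) m = coef f (m - u).
Proof.
move=> lf; suff [] : laurent f /\ forall m, coef (mon u * f) m = coef f (m - u)
  by [].
elim/span_ind: f / lf m => [m|f g IHf IHg m|a m' _ _].
- by split=> [|m']; [exact: span0|rewrite mulr0 !coef0].
- have [[lf fE] [lg gE]] := (IHf m, IHg m); split=> [|m']; first exact: spanD.
  have lu : laurent (mon u) by exact: span_monomial.
  by rewrite mulrDr !coefD ?fE ?gE //; apply: laurentM.
- split=> [|m]; first exact: span_term.
  by rewrite mulrCA -monomialD !coef_term subr_eq addrC.
Qed.

Lemma coefZ a f m : laurent f -> coef (cst a * f) m = a * coef f m.
Proof.
move=> /laurent_has_coef[s [us c0 fE]].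
rewrite (@has_coef_coef _ (fun m => a * coef f m)) //.
exists s; split=> // [u /c0->|]; first by rewrite mulr0.
by rewrite {1}fE mulr_sumr; apply: eq_bigr => u _; rewrite rmorphM mulrA.
Qed.

Lemma laurentX f n : laurent f -> laurent (f ^+ n).
Proof.
move=> lf; elim: n => [|n IH]; last by rewrite exprS; exact: laurentM.
by rewrite expr0 -monomial0; exact: span_monomial.
Qed.

Lemma coef_inj f g : laurent f -> laurent g -> coef f =1 coef g -> f = g.
Proof.
move=> /laurent_has_coef h /laurent_has_coef h' /funext e; rewrite -e in h'.
by have [s [_ _ fE gE]] := has_coef_common h h'; rewrite [LHS]fE [RHS]gE.
Qed.

Lemma coef_support f : laurent f -> exists s : seq 'rV[int]_d,
  [/\ uniq s, forall m, (m \in s) = (coef f m != 0)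
    & f = \sum_(m <- s) cst (coef f m) * mon m].
Proof.
move=> /laurent_has_coef[s [us c0 fE]]; exists [seq m <- s | coef f m != 0].
split; first exact: filter_uniq.
  move=> m; rewrite mem_filter; case: eqP => //= c; apply: contraT => /c0 //.
rewrite {1}fE big_filter (bigID (fun m => coef f m == 0)) /= big1 ?add0r //.
by move=> m /eqP->; rewrite rmorph0 mul0r.
Qed.

Lemma laurent_neq0 f : laurent f -> f != 0 -> exists m, coef f m != 0.
Proof.
move=> /coef_support[[|m s] [_ sP fE]]; first by rewrite {1}fE big_nil eqxx.
by exists m; rewrite -sP mem_head.
Qed.

End Laurent.

Arguments cst {k d} c.

(** * Orders along toric divisors *)

Section Order.
Variables (k : fieldType) (d : nat) (v : 'cV[int]_d).
Local Notation K := (ratfun k d).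
Implicit Types (m u : 'rV[int]_d) (f g h : K) (S : set 'rV[int]_d).
Local Notation mon := (monomial k).

(** The monomial valuation of weight [v], read off from the support. [order_at_ord] identifies it
    with [ord], which is defined by a choice in the local ring. *)
Definition order_at f (j : int) : Prop :=
  [/\ laurent f, forall m, coef f m != 0 -> j <= pairing m v
    & exists2 m, coef f m != 0 & pairing m v = j].

Lemma order_at_exists f : laurent f -> f != 0 -> exists j, order_at f j.
Proof.
move=> lf f0; have [s [_ sP _]] := coef_support lf.
have [m1 m1s] : exists m, m \in s by have [m] := laurent_neq0 lf f0;
  rewrite -sP; exists m.
have [m ms mmin] : exists2 m, m \in s & forall m', m' \in s ->
  pairing m v <= pairing m' v.
  elim: s {sP} m1 m1s => // a s IH _ _.
  case: s IH => [_|b s /(_ b (mem_head _ _))[m ms mmin]].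
    by exists a; rewrite ?mem_head // => m'; rewrite inE => /eqP->.
  have [am|ma] := leP (pairing a v) (pairing m v).
    exists a; first exact: mem_head.
    by move=> m'; rewrite inE => /orP[/eqP->//|/mmin]; exact: le_trans.
  exists m; first by rewrite inE ms orbT.
  by move=> m'; rewrite inE => /orP[/eqP->|/mmin//]; exact: ltW.
exists (pairing m v); split=> //; last by exists m; rewrite -?sP.
by move=> m'; rewrite -sP => /mmin.
Qed.

Lemma span_split S f (Q : pred 'rV[int]_d) : monomial_span S f ->
  exists f0 f1, [/\ f = f0 + f1, monomial_span [set m | S m /\ Q m] f0
    & monomial_span [set m | S m /\ ~~ Q m] f1].
Proof.
move=> /spanP[lf fS]; have [s [_ sP fE]] := coef_support lf.
exists (\sum_(m <- s | Q m) cst (coef f m) * mon m).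
exists (\sum_(m <- s | ~~ Q m) cst (coef f m) * mon m).
split; first by rewrite {1}fE (bigID Q).
  rewrite big_seq_cond; apply: span_sum => m /andP[]; rewrite sP => /fS ? ?.
  exact: span_term.
rewrite big_seq_cond; apply: span_sum => m /andP[]; rewrite sP => /fS ? ?.
exact: span_term.
Qed.

Lemma order_at_initial f j : order_at f j -> exists f0 f1,
  [/\ f = f0 + f1, f0 != 0, monomial_span [set m | pairing m v = j] f0
    & monomial_span [set m | j < pairing m v] f1].
Proof.
move=> [lf fj [m fm mj]].
have fS : monomial_span [set m | j <= pairing m v] f by apply/spanP.
have [f0 [f1 [fE f0S f1S]]] := span_split (fun m => pairing m v == j) fS.
have {}f1S : monomial_span [set m | j < pairing m v] f1.
  by apply: sub_span f1S => u /= [uj ju]; rewrite lt_neqAle eq_sym ju.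
exists f0, f1; split=> //; last by apply: sub_span f0S => u /= [_ /eqP].
apply: contraNneq fm => f00; have /spanP[_ h] : monomial_span [set m | j <
  pairing m v] f.
  by rewrite fE f00 add0r.
by apply: contraT => /h /=; rewrite mj ltxx.
Qed.

(** The initial forms have a nonzero product in the function field, homogeneous of degree j + j'.
    All other terms have larger degree and cannot cancel it. *)
Lemma order_atM f g j j' : order_at f j -> order_at g j' ->
  order_at (f * g) (j + j').
Proof.
move=> fj gj; have [lf fle _] := fj; have [lg gle _] := gj.
have [f0 [f1 [fE f00 f0S f1S]]] := order_at_initial fj.
have [g0 [g1 [gE g00 g0S g1S]]] := order_at_initial gj.
have fS : monomial_span [set m | j <= pairing m v] f by apply/spanP.
have fg0 : monomial_span [set m | pairing m v = j + j'] (f0 * g0).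
  by apply: spanM f0S g0S => m u /= <- <-; rewrite pairingDl.
have fg1 : monomial_span [set m | j + j' < pairing m v] (f0 * g1 + f1 * g).
  apply: spanD.
    by apply: spanM f0S g1S => m u /= <-; rewrite pairingDl ltrD2l.
  have gS : monomial_span [set m | j' <= pairing m v] g by apply/spanP.
  by apply: spanM f1S gS => m u /= mj uj; rewrite pairingDl ltr_leD.
have fgE : f * g = f0 * g0 + (f0 * g1 + f1 * g).
  by rewrite addrA -mulrDr -gE -mulrDl -fE.
split.
- exact: laurentM.
- have gS : monomial_span [set m | j' <= pairing m v] g by apply/spanP.
  have /spanP[_ h] : monomial_span [set m | j + j' <= pairing m v] (f * g).
    by apply: spanM fS gS => m u /= mj uj; rewrite pairingDl lerD.
  exact: h.
- have [m m0] := laurent_neq0 (span_laurent fg0) (mulf_neq0 f00 g00).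
  have mj : pairing m v = j + j' by have /spanP[_ /(_ m m0)] := fg0.
  exists m => //; rewrite fgE coefD; [|exact: span_laurent fg0|exact:
    span_laurent fg1].
  suff -> : coef (f0 * g1 + f1 * g) m = 0 by rewrite addr0.
  apply/eqP; apply: contraT => h; have /spanP[_ /(_ m h)] := fg1.
  by rewrite /= mj ltxx.
Qed.

Lemma order_at_neq0 f j : order_at f j -> f != 0.
Proof. by move=> [_ _ [m fm _]]; apply: contraNneq fm => ->; rewrite coef0. Qed.

Lemma order_at_uniq f j j' : order_at f j -> order_at f j' -> j = j'.
Proof.
move=> [_ h [m fm mj]] [_ h' [m' fm' mj']]; apply/eqP; rewrite eq_le.
by rewrite -{1}mj' (h _ fm') -mj (h' _ fm).
Qed.

Lemma order_at_monomial m : order_at (mon m) (pairing m v).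
Proof.
split; first exact: span_monomial.
  by move=> u; rewrite coef_monomial; have [->//|_] := eqVneq u m; rewrite eqxx.
by exists m => //; rewrite coef_monomial eqxx oner_eq0.
Qed.

Local Notation O := (divisor_local_ring v : set K).

Lemma local_ringP f : O f <-> exists a b,
  [/\ monomial_span [set m | 0 <= pairing m v] a, order_at b 0 & f = a / b].
Proof.
split=> [[a [b [aS bS bN fE]]]|[a [b [aS b0 fE]]]]; exists a, b; split=> //.
- have /spanP[lb ble] := bS; split=> //.
  apply: contrapT => nb; apply: bN; apply/spanP; split=> // m bm.
  rewrite /= lt_neqAle (ble m bm) andbT; apply/negP => /eqP mv.
  by apply: nb; exists m.
- by have [lb bm _] := b0; apply/spanP.
- by move=> /spanP[_ h]; have [_ _ [m /h /= + m0]] := b0; rewrite m0 ltxx.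
Qed.

Lemma local_ring_span f : monomial_span [set m | 0 <= pairing m v] f -> O f.
Proof.
move=> fS; apply/local_ringP; exists f, 1; split;
  rewrite ?divr1 // -(monomial0 k d).
by rewrite -[X in order_at _ X](pairing0l v); exact: order_at_monomial.
Qed.

Lemma local_ringM f g : O f -> O g -> O (f * g).
Proof.
move=> /local_ringP[a [b [aS b0 ->]]] /local_ringP[a' [b' [aS' b0' ->]]].
apply/local_ringP; exists (a * a'), (b * b'); split.
- by apply: spanM aS aS' => m u /= *; rewrite pairingDl addr_ge0.
- by rewrite -[0]addr0; exact: order_atM.
- by rewrite invfM mulrACA.
Qed.

Lemma local_ringD f g : O f -> O g -> O (f + g).
Proof.
move=> /local_ringP[a [b [aS b0 ->]]] /local_ringP[a' [b' [aS' b0' ->]]].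
have bS : monomial_span [set m | 0 <= pairing m v] b by apply/spanP; case: b0.
have bS' : monomial_span [set m | 0 <= pairing m v] b' by apply/spanP;
  case: b0'.
apply/local_ringP; exists (a * b' + a' * b), (b * b'); split.
- by apply: spanD; [apply: spanM aS bS'|apply: spanM aS' bS] => m u /= *;
    rewrite pairingDl addr_ge0.
- by rewrite -[0]addr0; exact: order_atM.
- exact: (addf_div _ _ (order_at_neq0 b0) (order_at_neq0 b0')).
Qed.

Lemma local_ring_monomial m : O (mon m) <-> 0 <= pairing m v.
Proof.
split=> [/local_ringP[a [b [aS b0 mE]]]|m0]; last
  exact/local_ring_span/span_monomial.
have aE : mon m * b = a by rewrite mE divfK // (order_at_neq0 b0).
have := order_atM (order_at_monomial m) b0; rewrite aE addr0.
by move=> [_ _ [u au <-]]; have /spanP[_ h] := aS; exact: h.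
Qed.

(** The choice in [ord] is harmless: if two monomials both differ from [h] by units of the local
    ring, their quotient is a unit, so they have the same pairing with [v]. *)
Lemma ordE h m : h != 0 -> O (h / mon m) -> O (mon m / h) ->
  ord v h = pairing m v.
Proof.
move=> h0 hm mh; rewrite /ord; case: xgetP => [j ->
  [u <- [hu uh]]|/(_ (pairing m v))[]].
  have quot x y : O (mon x / h) -> O (h / mon y) -> pairing y v <= pairing x v.
    move=> Ox Oy; rewrite -subr_ge0 -pairingBl; apply/local_ring_monomial.
    have -> : mon (x - y) = (mon x / h) * (h / mon y).
      by rewrite monomialB mulrA divfK.
    exact: local_ringM.
  by apply/eqP; rewrite eq_le !quot.
by exists m.
Qed.

Lemma order_at_ord f j : order_at f j -> ord v f = j.
Proof.
move=> fj; have [lf fle [m fm mj]] := fj.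
have f0 := order_at_neq0 fj.
have o0 : order_at (f / mon m) 0.
  rewrite -(subrr j) -{2}mj -pairingNl -monomialN.
  exact: order_atM (order_at_monomial _).
rewrite -mj; apply: ordE => //.
  by apply: local_ring_span; apply/spanP; case: o0.
apply/local_ringP; exists 1, (f / mon m); split=> //;
  last by rewrite div1r invf_div.
by rewrite -(monomial0 k d); apply: span_monomial; rewrite /= pairing0l.
Qed.

(** A monomial of least order generates the extension of [a] to the local ring, and any other
    generator differs from it by a unit. *)
Lemma ideal_ordE (a : set K) m : a (mon m) ->
  a `<=` monomial_span [set u | pairing m v <= pairing u v] ->
  ideal_ord a v = pairing m v.
Proof.
move=> am aS.
have gE : submodule_gen O a = principal O (mon m).
  rewrite predeqE => f; split.
    move=> /(_ (principal O (mon m))); apply; last first.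
      move=> g /aS gS; exists (g / mon m); last by rewrite mulrC divfK //
        monomial_neq0.
      apply: local_ring_span; rewrite -monomialN.
      have mS : monomial_span [set - m] (mon (- m)) by exact: span_monomial.
      apply: spanM gS mS => u _ /= mu ->.
      by rewrite pairingDl pairingNl subr_ge0.
    split.
    - by exists 0; rewrite ?mulr0 //; apply/local_ring_span/span0.
    - move=> _ _ [x Ox <-] [y Oy <-]; exists (x + y); first exact: local_ringD.
      by rewrite mulrDr.
    - move=> r _ Or [x Ox <-]; exists (r * x); first exact: local_ringM.
      by rewrite mulrCA.
  move=> [x Ox <-] I [I0 ID IM] aI; rewrite mulrC; apply: IM => //; exact: aI.
have O1 : O 1.
  by apply: local_ring_span; rewrite -(monomial0 k d); apply: span_monomial;
    rewrite /= pairing0l.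
rewrite /ideal_ord; case: xgetP => [j -> [h [h0 hE <-]]|/(_ (pairing m v))[]].
  rewrite gE in hE; apply: ordE => //.
    have : principal O h h by exists 1; rewrite ?mulr1.
    rewrite -hE => -[x Ox <-]; rewrite mulrC.
    by rewrite (mulKf (monomial_neq0 _ _)); exact: Ox.
  have : principal O (mon m) (mon m) by exists 1; rewrite ?mulr1.
  by rewrite hE => -[x Ox <-]; rewrite mulrC (mulKf h0); exact: Ox.
exists (mon m); split; [exact: monomial_neq0|by []|].
exact/order_at_ord/order_at_monomial.
Qed.

End Order.

(** * Inverse Frobenius maps *)

(* The kernel of the functional is a maximal subspace of k over its subfield of
   q-th powers that avoids c0. *)
Lemma frobenius_functional (k : fieldType) (q : nat) (c0 : k) : (0 < q)%N ->
  (forall x y : k, (x + y) ^+ q = x ^+ q + y ^+ q) -> c0 != 0 ->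
  exists p : k -> k, [/\ forall x y, p (x + y) = p x + p y,
    forall a x, p (a ^+ q * x) = a * p x & p c0 = 1].
Proof.
move=> q0 frob c00.
have frob0 : 0 ^+ q = 0 :> k by rewrite expr0n; case: q q0 {frob}.
have frobN (x : k) : (- x) ^+ q = - x ^+ q.
  by apply/eqP; rewrite -addr_eq0 -frob addNr frob0.
pose good (H : set k) := [/\ forall x y, H x -> H y -> H (x + y),
  forall a x, H x -> H (a ^+ q * x) & ~ H c0].
have [|H [[HD HZ Hc0] Hmax]] := @Zorn_bigcup k good.
  move=> F Fgood Ftot; split.
  - move=> x y [X FX Xx] [Y FY Yy].
    have [XY|YX] := Ftot X Y FX FY.
      by exists Y => //; have [YD _ _] := Fgood Y FY; apply: YD => //;
        exact: XY.
    by exists X => //; have [XD _ _] := Fgood X FX; apply: XD => //; exact: YX.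
  - move=> a x [X FX Xx]; exists X => //.
    by have [_ XZ _] := Fgood X FX; exact: XZ.
  - by move=> [X FX Xc0]; have [_ _] := Fgood X FX.
(* [good] does not ask for 0, because the union of the empty chain must be good; maximality supplies
   it. *)
have H0 : H 0.
  apply: contrapT => nH0; apply: (Hmax (H `|` [set 0])).
    by split=> [x|/(_ 0)]; [left|move=> h; apply: nH0; apply: h; right].
  split=> [x y [Hx|->] [Hy|->]|a x [Hx|->]|[//|/eqP]].
  - by left; exact: HD.
  - by rewrite addr0; left.
  - by rewrite add0r; left.
  - by rewrite addr0; right.
  - by left; exact: HZ.
  - by rewrite mulr0; right.
  - by rewrite (negPf c00).
have HN x : H x -> H (- x).
  by move=> Hx; rewrite -mulN1r -[1](expr1n _ q) -frobN; exact: HZ.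
have ex x : exists l, H (x - l ^+ q * c0).
  have [Hx|nHx] := pselect (H x); first by exists 0; rewrite frob0 mul0r subr0.
  (* For x outside [H], maximality puts c0 = h + m^q x in the span of [H] and x. Solving for x shows
     that it is m^-q c0 modulo [H]. *)
  pose H' := [set y | exists2 h, H h & exists m, y = h + m ^+ q * x].
  have : ~ good H'.
    apply: Hmax; split=> [y Hy|/(_ x)].
      by exists y => //; exists 0; rewrite frob0 mul0r addr0.
    by move=> h; apply: nHx; apply: h; exists 0 => //; exists 1;
      rewrite expr1n mul1r add0r.
  have [[h Hh [m c0E]] _|nc0 []] := pselect (H' c0).
    have m0 : m ^+ q != 0.
      apply: contra_notN Hc0 => /eqP m0; rewrite c0E m0 mul0r addr0 //.
    exists m^-1; have -> : x - m^-1 ^+ q * c0 = - (m^-1 ^+ q * h).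
      by rewrite c0E mulrDr mulrA exprVn mulVf // mul1r opprD addrCA subrr
        addr0.
    exact/HN/HZ.
  split=> //.
    move=> _ _ [h Hh [m ->]] [h' Hh' [m' ->]]; exists (h + h'); first exact: HD.
    by exists (m + m'); rewrite frob mulrDl addrACA.
  move=> a _ [h Hh [m ->]]; exists (a ^+ q * h); first exact: HZ.
  by exists (a * m); rewrite mulrDr mulrA exprMn.
have uniq x l m : H (x - l ^+ q * c0) -> H (x - m ^+ q * c0) -> l = m.
  move=> Hl Hm; apply/eqP; apply: contra_notT Hc0 => lm.
  have lm0 : (l - m) ^+ q != 0 by rewrite expf_neq0 // subr_eq0.
  have := HZ (l - m)^-1 _ (HD _ _ Hm (HN _ Hl)).
  have -> : x - m ^+ q * c0 - (x - l ^+ q * c0) = (l - m) ^+ q * c0.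
    by rewrite frob frobN; ring.
  by rewrite exprVn mulrA mulVf // mul1r.
have [p pP] := choice ex; exists p; split.
- move=> x y; apply: (uniq (x + y)) => //.
  by rewrite frob mulrDl opprD addrACA; exact: HD.
- move=> a x; apply: (uniq (a ^+ q * x)) => //.
  by rewrite exprMn -mulrA -mulrBr; exact: HZ.
- by apply: (uniq c0) => //; rewrite expr1n mul1r subrr.
Qed.

Section Cartier.
Variables (k : fieldType) (d q : nat) (b : 'rV[int]_d) (p : k -> k).
Hypothesis q0 : (0 < q)%N.
Hypothesis pD : forall x y, p (x + y) = p x + p y.
Hypothesis pZ : forall a x, p (a ^+ q * x) = a * p x.
Local Notation K := (ratfun k d).
Hypothesis frobK : forall x y : K, (x + y) ^+ q = x ^+ q + y ^+ q.
Implicit Types (f g h : K).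
Local Notation mon := (monomial k).

Let is_cartier f g := laurent g /\ forall m, coef g m = p (coef f (m *+ q + b)).

Definition cartier f : K := xget 0 (is_cartier f).

Let p0 : p 0 = 0.
Proof. by have := pD 0 0; rewrite addr0 => /eqP;
  rewrite -subr_eq0 opprD addrA subrr sub0r oppr_eq0 => /eqP. Qed.

Let mulrn_inj (m u : 'rV[int]_d) : m *+ q = u *+ q -> m = u.
Proof.
move=> /rowP h; apply/rowP => j; have := h j; rewrite !mulmxnE; exact: pmulrnI.
Qed.

Lemma cartierP f : laurent f -> laurent (cartier f) /\
  forall m, coef (cartier f) m = p (coef f (m *+ q + b)).
Proof.
move=> lf; suff [g gP] : exists g, is_cartier f g.
  by rewrite /cartier; case: xgetP => [g' -> //|/(_ g)].
suff [] : laurent f /\ exists g, is_cartier f g by [].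
elim/span_ind: f / lf => [|f g [lf [f' [lf' fE]]] [lg [g' [lg' gE]]]|a u _].
- by split; [exact: span0|exists 0; split=> [|m]; rewrite ?coef0 ?p0 //;
    exact: span0].
- split; first exact: spanD.
  exists (f' + g'); split=> [|m]; first exact: spanD.
  by rewrite !coefD // pD fE gE.
split; first exact: span_term.
have [[m uE]|nu] := pselect (exists m, u = m *+ q + b).
  exists (cst (p a) * mon m); split=> [|m']; first exact: span_term.
  rewrite !coef_term uE (inj_eq (addIr b)); have [->|m'm] := eqVneq m' m.
    by rewrite eqxx.
  rewrite (_ : (m' *+ q == m *+ q) = false) ?mulr0n ?p0 //.
  by apply/eqP => /mulrn_inj /eqP; rewrite (negPf m'm).
exists 0; split=> [|m]; first exact: span0.
rewrite coef0 coef_term; case: eqP => [uE|_]; last by rewrite p0.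
by case: nu; exists m.
Qed.

Lemma cartierD f g : laurent f -> laurent g -> cartier (f + g) = cartier f +
  cartier g.
Proof.
move=> lf lg; have [lf' fE] := cartierP lf; have [lg' gE] := cartierP lg.
have [lfg fgE] := cartierP (spanD lf lg).
apply: coef_inj => //; first exact: spanD.
by move=> m; rewrite fgE !coefD // pD fE gE.
Qed.

(** Additivity of the q-th power reduces to f = a x^u: the factor x^(q u) translates exponents by q
    u, which the map turns into u, and [pZ] extracts [a]. *)
Lemma cartierM f h : laurent f -> laurent h ->
  cartier (f ^+ q * h) = f * cartier h.
Proof.
move=> lf lh; have [lh' hE] := cartierP lh.
suff [] : laurent f /\ cartier (f ^+ q * h) = f * cartier h by [].
elim/span_ind: f / lf => [|f g [lf fE] [lg gE]|a u _].
- split; first exact: span0.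
  rewrite expr0n; case: (q) q0 => //= n _; rewrite !mul0r.
  have [l0 c0] := cartierP (span0 _ _ : laurent (0 : K)).
  by apply: coef_inj => //; [exact: span0|move=> m; rewrite c0 !coef0 p0].
- split; first exact: spanD.
  rewrite frobK !mulrDl cartierD ?fE ?gE //.
    by apply: laurentM => //; exact: laurentX.
  by apply: laurentM => //; exact: laurentX.
split; first exact: span_term.
have lu m : laurent (mon m) by exact: span_monomial.
rewrite exprMn -rmorphXn -monomialMn -!mulrA.
have lmh : laurent (mon (u *+ q) * h) by exact: laurentM.
have [l1 c1] := cartierP (spanZ (a ^+ q) lmh).
apply: coef_inj => // [|m]; first by apply/spanZ/laurentM.
rewrite c1 !coefZ //; last exact: laurentM.
rewrite !coef_monomialM // pZ hE; congr (_ * p (coef h _)).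
by rewrite mulrnBl addrAC.
Qed.

(** If <m, n_i> <= -1, then <q m + b, n_i> <= <b, n_i> - q < 0, so x^m can only come from an
    exponent outside the dual cone. *)
Lemma cartier_span s (n : 'I_s -> 'cV[int]_d) f :
  (forall i, pairing b (n i) < q%:Z) ->
  monomial_span [set m | forall i, 0 <= pairing m (n i)] f ->
  monomial_span [set m | forall i, 0 <= pairing m (n i)] (cartier f).
Proof.
move=> bq /spanP[lf fS]; have [l1 c1] := cartierP lf; apply/spanP; split=> // m.
rewrite c1 => cm i; have : coef f (m *+ q + b) != 0.
  by apply: contraNneq cm => ->; rewrite p0.
move=> /fS /(_ i); rewrite pairingDl pairingMn -mulr_natr => h.
rewrite leNgt; apply/negP => mneg; have := bq i.
rewrite ltNge => /negP; apply.
have : 0 <= pairing m (n i) * q%:Z + pairing b (n i) by rewrite -(natz q).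
by move: mneg q0 => {h}; set x := pairing m _; set y := pairing b _; nia.
Qed.

End Cartier.

(** * The two ideals of a toric ideal *)

Section Ideals.
Variable K : comNzRingType.
Implicit Types (A R I S : set K).

Lemma sub_submodule_gen A S : S `<=` submodule_gen A S.
Proof. by move=> x Sx I _; apply. Qed.

Lemma submodule_gen_submodule A S : is_submodule A (submodule_gen A S).
Proof.
split.
- by move=> I [].
- by move=> x y hx hy I Im SI; have [_ + _] := Im; apply; [exact: hx|exact: hy].
- by move=> r x Ar hx I Im SI; have [_ _] := Im; apply=> //; exact: hx.
Qed.

Lemma submodule_gen_min A S I : is_submodule A I -> S `<=` I ->
  submodule_gen A S `<=` I.
Proof. by move=> Im SI x; apply. Qed.

End Ideals.

Lemma zero_prime (K : fieldType) (R : set K) : R 0 -> is_prime R [set 0].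
Proof.
move=> R0; split.
- split=> [x ->//|]; split=> //.
    by move=> x y -> ->; rewrite addr0.
  by move=> r x _ ->; rewrite mulr0.
- by move=> /eqP; rewrite oner_eq0.
- by move=> x y _ _ /eqP; rewrite mulf_eq0 => /orP[] /eqP; [left|right].
Qed.

(** The zero ideal is prime and contained in every prime, hence it is the only minimal prime. *)
Lemma domain_ring_circ (K : fieldType) (R : set K) (c : K) :
  R 0 -> ring_circ R c <-> R c /\ c <> 0.
Proof.
move=> R0; split=> [[Rc h]|[Rc c0]]; split=> //.
  apply: (h [set 0]); split; first exact: zero_prime.
  move=> Q [[_ [Q0 _ _]] _ _] Q0'; rewrite predeqE => x; split;
    first exact: Q0'.
  by move=> ->.
move=> P [[[PR [P0 PD PM]] P1 PP] Pmin] Pc.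
have P0E : [set 0 : K] = P by apply: Pmin; [exact: zero_prime|move=> x ->].
by apply: c0; move: Pc; rewrite -P0E.
Qed.

Section TauToric.
Variables (RR : realType) (k : fieldType) (p : nat) (d : nat) (sigma : set
  'cV[RR]_d).
Hypothesis hsigma : strongly_convex_rational_cone sigma.
Variables (s : nat) (n : 'I_s -> 'cV[int]_d).
Hypothesis hn_inj : injective n.
Hypothesis hn : range n = fan_rays (faces sigma).
Variables (w : 'rV[RR]_d) (a : set (ratfun k d)).
Hypothesis hw : forall i, pairing w (map_mx intr (n i)) = 1.
Hypothesis ha : is_toric_ideal sigma a.
Hypothesis ha0 : a <> [set 0].
Local Notation K := (ratfun k d).
Local Notation mon := (monomial k).
Local Notation R := (toric_ring k sigma).
Local Notation S := (dual_lattice_points sigma).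
Local Notation real := (map_mx (intr : int -> RR)).
Local Notation Int_P := (relative_interior (newton_polygon RR a)).

Lemma semigroupP m : S m <-> forall i, 0 <= pairing m (n i).
Proof. exact: (dual_lattice_pointsP hsigma hn). Qed.

Lemma semigroup0 : S 0.
Proof. by apply/semigroupP => i; rewrite pairing0l. Qed.

Lemma semigroupD m u : S m -> S u -> S (m + u).
Proof. by move=> /semigroupP m0 /semigroupP u0; apply/semigroupP => i;
  rewrite pairingDl addr_ge0. Qed.

Lemma toric_ring_monomial m : R (mon m) <-> S m.
Proof.
split=> [/spanP[_]|]; last exact: span_monomial.
by apply; rewrite coef_monomial eqxx oner_eq0.
Qed.

Lemma toric_ring0 : R 0. Proof. exact: span0. Qed.

Lemma toric_ring1 : R 1. Proof. by rewrite -(monomial0 k d);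
  apply/toric_ring_monomial/semigroup0. Qed.

Lemma toric_ringM f g : R f -> R g -> R (f * g).
Proof. exact: spanM semigroupD. Qed.

Lemma span_ideal (T : set 'rV[int]_d) : T `<=` S ->
  (forall m u, T m -> S u -> T (m + u)) -> is_ideal R (monomial_span T : set K).
Proof.
move=> TS TD; split; first exact: sub_span.
split; [exact: span0|exact: spanD|move=> r x Rr Tx].
by rewrite mulrC; exact: spanM TD Tx Rr.
Qed.

Lemma toric_ideal_submodule : is_submodule R a.
Proof. by have [T _ ->] := ha; exact: submodule_gen_submodule. Qed.

Lemma toric_ideal_exponentD m u : a (mon m) -> S u -> a (mon (m + u)).
Proof.
move=> am Su; have [_ _ aM] := toric_ideal_submodule.
by rewrite addrC monomialD; apply: aM => //; apply/toric_ring_monomial.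
Qed.

Lemma toric_ideal_sub : a `<=` R.
Proof.
have [T TS ->] := ha; apply: submodule_gen_min.
  by split; [exact: span0|exact: spanD|exact: toric_ringM].
by move=> _ [m Tm <-]; apply/toric_ring_monomial/TS.
Qed.

Lemma toric_ideal_span : a `<=` monomial_span [set m | a (mon m)].
Proof.
have [T TS aE] := ha; rewrite {1}aE; apply: submodule_gen_min.
  have AS : [set m | a (mon m)] `<=` S by move=> m
    /toric_ideal_sub/toric_ring_monomial.
  exact: (span_ideal AS toric_ideal_exponentD).2.
move=> _ [m Tm <-]; apply: span_monomial => /=; rewrite aE.
by apply: sub_submodule_gen; exists m.
Qed.

Lemma toric_ideal_exponent : exists m, a (mon m).
Proof.
apply: contrapT => nA; apply: ha0; rewrite predeqE => x; split=> [ax|->].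
  have [t [c [m [am ->]]]] := toric_ideal_span ax.
  by apply: big1 => i _; case: nA; exists (m i); exact: am.
by have [] := toric_ideal_submodule.
Qed.

Lemma exponent_ge0 m : a (mon m) -> forall i, 0 <= pairing m (n i).
Proof. by move=> /toric_ideal_sub/toric_ring_monomial/semigroupP. Qed.

Lemma newton_support_interior y :
  (forall c : 'I_s -> RR, (forall i, 0 <= c i) ->
    \sum_i c i *: real (n i) != 0 ->
    exists2 m, a (mon m) & pairing (real m) (\sum_i c i *: real (n i)) <
      pairing y (\sum_i c i *: real (n i))) -> Int_P y.
Proof.
have [xi xiP] := interior_lattice_point hsigma hn;
  have [m am] := toric_ideal_exponent.
apply: (@support_interior RR d s n xi xiP [set m | a (mon m)] exponent_ge0 _ m
  am).
by move=> m' t /= am' /semigroupP St; exact: toric_ideal_exponentD.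
Qed.

Lemma newton_interior_support y (c : 'I_s -> RR) : Int_P y ->
  (forall i, 0 <= c i) ->
  \sum_i c i *: real (n i) != 0 ->
    exists2 m, a (mon m) & pairing (real m) (\sum_i c i *: real (n i)) <
      pairing y (\sum_i c i *: real (n i)).
Proof.
have [xi xiP] := interior_lattice_point hsigma hn;
  have [m am] := toric_ideal_exponent.
apply: (@interior_support RR d s n xi xiP [set m | a (mon m)] _ m am).
by move=> m' t /= am' /semigroupP St; exact: toric_ideal_exponentD.
Qed.

(** * Upper bound: the exponents of elements of tau *)

Lemma pairing_shift m i :
  pairing (real m + w) (real (n i)) = (pairing m (n i) + 1)%:~R.
Proof. by rewrite pairingDl hw pairing_intr intrD. Qed.

(** [B j] bounds the exponents of products of j elements of [a]. Only the last stage must be stable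
    under the semigroup, since multiplication by R takes place once, after the products are
    formed. *)
Lemma ideal_pow_span (B : nat -> set 'rV[int]_d) q : B 0%N 0 ->
  (forall j m u, B j m -> a (mon u) -> B j.+1 (m + u)) ->
  (forall m u, B q m -> S u -> B q (m + u)) ->
  ideal_pow R a q `<=` (monomial_span (B q) : set K).
Proof.
move=> B0 BD BS; apply: submodule_gen_min.
  split; [exact: span0|exact: spanD|move=> r x Rr Bx].
  by rewrite mulrC; exact: spanM BS Bx Rr.
move=> _ [u /= au <-]; elim: q {BS} u au => [|q IH] u au.
  by rewrite big_ord0 -(monomial0 k d); exact: span_monomial.
rewrite big_ord_recr /=; apply: spanM (BD q) _ (toric_ideal_span (au _)).
by apply: IH => i; exact: au.
Qed.

Lemma tau_coef z m : tau R p a z -> coef z m != 0 -> Int_P (real m + w).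
Proof.
move=> [Rz hz] zm; apply: newton_support_interior => c c0 v0.
apply: contrapT => nA.
have Sm : S m by have /spanP[_] := Rz; apply.
pose h i := pairing m (n i) + 1.
have {}nA u : a (mon u) ->
    \sum_i c i * (h i)%:~R <= \sum_i c i * (pairing u (n i))%:~R.
  move=> au; rewrite leNgt; apply/negP => lt; apply: nA; exists u => //.
  rewrite !pairing_sumr; under eq_bigr do rewrite pairingZr
    pairing_intr.
  by under [ltRHS]eq_bigr do rewrite pairingZr pairing_shift.
(* The weights [c] may be irrational, but an inequality between weighted sums holds for at least one
   index, where it is a statement about integers. That index depends on [u]. *)
have some_facet (u : 'rV[int]_d) q : \sum_i c i * (h i *+ q)%:~R <= \sum_i c i
  * (pairing u (n i))%:~R ->
    exists i, h i *+ q <= pairing u (n i).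
  move=> le; apply: contrapT => /forallNP nle.
  have lt i : pairing u (n i) < h i *+ q by rewrite ltNge; apply/negP/nle.
  have [i ci] : exists i, 0 < c i.
    apply: contrapT => /forallNP nc; move/eqP: v0; apply; apply: big1 => i _.
    by have /eqP -> : c i == 0; [rewrite eq_le c0 andbT leNgt;
      apply/negP/nc|rewrite scale0r].
  move: le; rewrite leNgt => /negP; apply.
  rewrite (bigD1 i) //= [ltRHS](bigD1 i) //= ltr_leD ?ltr_pM2l ?ltr_int //.
  by apply: ler_sum => j _; rewrite ler_wpM2l // ler_int ltW.
(* The value -1 on [n i] puts x^(t - x_i) into the ideal spanned by [T], and offsets the summand 1
   of [h i]. *)
have [x xP] := choice (fun i =>
  facet_shift hsigma hn_inj hn i (-1) (fun j => pairing m (n j))).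
have [xi xiP] := interior_lattice_point hsigma hn.
(* [N] bounds the pairings of [m] and of all [x i] with the generators, so that t - m and every t -
   x_i lie in the semigroup. *)
pose N := (\sum_j (`|pairing m (n j)| + \sum_i `|pairing (x i) (n j)|))%N.
pose t := xi *+ N.
have tN j : N%:Z <= pairing t (n j).
  by rewrite pairingMn -mulr_natr natz ler_peMl //; exact: xiP.
have tm : S (t - m).
  apply/semigroupP => j; rewrite pairingBl subr_ge0; apply: le_trans (tN j).
  have : (`|pairing m (n j)| <= N)%N by rewrite /N (bigD1 j) //= -addnA
    leq_addr.
  by lia.
have tx i : S (t - x i).
  apply/semigroupP => j; rewrite pairingBl subr_ge0; apply: le_trans (tN j).
  have : (`|pairing (x i) (n j)| <= N)%N.
    by rewrite /N (bigD1 j) //= (bigD1 i) //= -addnA addnCA -addnA leq_addr.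
  by lia.
pose T := [set u | S u /\ ~ S (t - u)].
have TS : T `<=` S by move=> u [].
have TI : is_ideal R (monomial_span T : set K).
  apply: span_ideal => // u u' [Su nSu] Su'; split; first exact: semigroupD.
  move=> h'; apply: nSu; have -> : t - u = t - (u + u') + u'.
    by rewrite opprD addrA subrK.
  exact: semigroupD.
have [_ zI] := hz _ TI.
have : monomial_span T (z * mon (t - m)).
  apply: zI; split; first exact/toric_ring_monomial.
  exists 1; first by apply/domain_ring_circ; [exact: toric_ring0|split;
    [exact: toric_ring1|exact/eqP/oner_neq0]].
  exists 0%N => e _ y; set q := (p ^ e)%N; rewrite mul1r => ay.
  pose B (j : nat) := [set u | S u /\
    \sum_i c i * (h i *+ j)%:~R <= \sum_i c i * (pairing u (n i))%:~R].
  have sumD (u u' : 'rV[int]_d) : \sum_i c i * (pairing (u + u') (n i))%:~R =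
      \sum_i c i * (pairing u (n i))%:~R + \sum_i c i * (pairing u' (n i))%:~R.
    by rewrite -big_split; apply: eq_bigr => i _;
      rewrite pairingDl intrD mulrDr.
  have : monomial_span (B q) y.
    apply: ideal_pow_span ay.
    - split; first exact: semigroup0.
      rewrite !big1 // => i _; rewrite ?mulr0n ?pairing0l mulr0 //.
    - move=> j u u' [Su Bu] au'; split; first
        exact/semigroupD/toric_ring_monomial/toric_ideal_sub.
      rewrite sumD (eq_bigr (fun i => c i * (h i *+ j)%:~R + c i * (h i)%:~R)).
        by rewrite big_split lerD // nA.
      by move=> i _; rewrite mulrSr intrD mulrDr.
    - move=> u u' [Su Bu] Su'; split; first exact: semigroupD.
      rewrite sumD -[leLHS]addr0 lerD //; apply: sumr_ge0 => i _.
      by rewrite mulr_ge0 // ler0z; move: i; exact/semigroupP.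
  have [F0 FD FM] := submodule_gen_submodule R [set x ^+ q | x in
    (monomial_span T : set K)].
  elim/span_ind: y / {ay} => [|f g hf hg|b u [Su /some_facet[i hi]]].
  - by rewrite mulr0; exact: F0.
  - by rewrite mulrDr; exact: FD.
  (* The cofactor of the q-th power has exponent u + q (x_i - m). It pairs with n_i to <u, n_i> - q
     h_i >= 0, and with any other n_j to at least <u, n_j>. *)
  have -> : mon (t - m) ^+ q * (cst b * mon u) =
      (cst b * mon ((t - m) *+ q + u - (t - x i) *+ q)) * mon (t - x i) ^+ q.
    rewrite -!monomialMn mulrCA -monomialD -[in RHS]mulrA -monomialD subrK //.
  apply: FM.
    apply: span_term; apply/semigroupP => j.
    have -> : (t - m) *+ q + u - (t - x i) *+ q = u + (x i - m) *+ q.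
      by rewrite addrAC -mulrnBl opprB [t - m + _]addrC addrA subrK addrC.
    rewrite pairingDl pairingMn pairingBl; have [xi1 xj] := xP i.
    have [->|ji] := eqVneq j i.
      rewrite xi1 -opprD mulNrn subr_ge0; move: hi.
      by rewrite /h [1 + _]addrC.
    by rewrite addr_ge0 //; [move: j {ji}; exact/semigroupP|rewrite mulrn_wge0
      // subr_ge0 xj].
  apply: sub_submodule_gen; exists (mon (t - x i)) => //.
  apply: span_monomial; split; first exact: tx.
  rewrite opprB addrC subrK => /semigroupP/(_ i); have [-> _] := xP i.
  by rewrite oppr_ge0 ler10.
move=> /spanP[_ /(_ t)]; rewrite mulrC coef_monomialM;
  last exact: span_laurent Rz.
rewrite subKr => /(_ zm)[_]; apply; rewrite subrr; exact: semigroup0.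
Qed.

(** * The multiplier ideal *)

Lemma divisor_sectionsE (Sigma : set (set 'cV[RR]_d)) (D : 'cV[int]_d -> int) :
  divisor_sections Sigma D =
    (monomial_span [set m | forall v, fan_rays Sigma v ->
      - D v <= pairing m v] : set K).
Proof.
have torusE f : toric_ring k [set 0 : 'cV[RR]_d] f <-> laurent f.
  split; first exact: span_laurent.
  by apply: sub_span => m _ x ->; rewrite pairing0r.
rewrite predeqE => f; split=> [[/torusE lf h]|fS].
  apply/spanP; split=> // m fm v Sv; have [f0|/(_ v Sv)] := h.
    by rewrite f0 coef0 eqxx in fm.
  have f0 : f != 0 by apply: contraNneq fm => ->; rewrite coef0.
  (* The order is the least value of [v] on the support, so the condition bears on each exponent
     separately. *)
  have [j jP] := order_at_exists v lf f0; rewrite (order_at_ord jP).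
  by have [_ /(_ m fm) jm _] := jP => h'; apply: le_trans jm;
    rewrite -subr_ge0 opprK.
have lf := span_laurent fS; split; first exact/torusE.
have [->|f0] := eqVneq f 0; [by left|right=> v Sv].
have [j jP] := order_at_exists v lf f0; rewrite (order_at_ord jP).
have [_ _ [m fm <-]] := jP; have /spanP[_ /(_ m fm v Sv)] := fS.
by rewrite -subr_ge0 opprK.
Qed.

Section Gorenstein.
Variables (r : nat) (g : K).
Hypothesis hr : (0 < r)%N.
Hypothesis hg : canonical_power k sigma r = principal R g.

Lemma canonical_powerE : canonical_power k sigma r =
  (monomial_span [set m | forall i, r%:Z <= pairing m (n i)] : set K).
Proof.
rewrite /canonical_power divisor_sectionsE; congr monomial_span.
rewrite predeqE => m; split=> h => [i|v].
  by have := h (n i); rewrite opprK; apply; rewrite -hn; exists i.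
by rewrite -hn => -[i _ <-]; rewrite opprK.
Qed.

(** [g] divides the monomial x^(r xi), hence is a unit of the Laurent ring: a constant times some
    x^m0. On sigma, m0 agrees with r w. *)
Lemma canonical_generator : exists m0, (forall i, pairing m0 (n i) = r%:Z) /\
  forall v, ord v g = pairing m0 v.
Proof.
have [xi xiP] := interior_lattice_point hsigma hn.
have quot m : (forall i, r%:Z <= pairing m (n i)) ->
    exists x, [/\ R x, x != 0, g != 0 & mon m = g * x].
  move=> mr; have : principal R g (mon m).
    by rewrite -hg canonical_powerE; exact: span_monomial.
  move=> [x Rx gx]; exists x.
  have : g * x != 0 by rewrite gx; exact: monomial_neq0.
  rewrite mulf_eq0 negb_or => /andP[g0 x0]; exact: And4 Rx x0 g0 (esym gx).
have [x [Rx x0 g0 xE]] : exists x, [/\ R x, x != 0,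
  g != 0 & mon (xi *+ r) = g * x].
  by apply: quot => i; rewrite pairingMn -mulr_natl natz ler_peMr //;
    exact: xiP.
have gS : monomial_span [set m | forall i, r%:Z <= pairing m (n i)] g.
  rewrite -canonical_powerE hg; exists 1; [exact: toric_ring1|exact: mulr1].
have lg := span_laurent gS; have lx := span_laurent Rx.
have [m0 gm0] := laurent_neq0 lg g0.
(* The orders of g and of its cofactor along v and - v add up to 0, so v is
   constant on the exponents of g; as v varies, g has a single exponent. *)
have const m v : coef g m != 0 -> pairing m v = pairing m0 v.
  move=> gm.
  have [j1 g1] := order_at_exists v lg g0; have [j2 g2] :=
    order_at_exists (- v) lg g0.
  have [l1 x1] := order_at_exists v lx x0; have [l2 x2] :=
    order_at_exists (- v) lx x0.
  have e1 := order_at_uniq (order_atM g1 x1); rewrite -xE in e1.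
  have {}e1 := e1 _ (order_at_monomial k v (xi *+ r)).
  have e2 := order_at_uniq (order_atM g2 x2); rewrite -xE in e2.
  have {}e2 := e2 _ (order_at_monomial k (- v) (xi *+ r)).
  rewrite pairingNr in e2.
  have [_ h1 _] := g1; have [_ h2 _] := g2; have [_ h3 [u xu _]] := x1;
    have [_ h4 _] := x2.
  have := h1 m gm; have := h2 m gm; have := h1 m0 gm0; have := h2 m0 gm0.
  have := h3 u xu; have := h4 u xu; rewrite !pairingNr.
  by move: e1 e2; lia.
have gE v : order_at v g (pairing m0 v).
  split=> //; last by exists m0.
  by move=> m gm; rewrite (const m v).
exists m0; split=> [i|v]; last exact: order_at_ord (gE v).
apply/eqP; rewrite eq_le; apply/andP; split; last first.
  by have /spanP[_ /(_ m0 gm0 i)] := gS.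
(* x^m has order exactly r along D_i and is [g] times an element of R, whence <m0, n_i> <= r. *)
have [m [mi mj]] := facet_shift hsigma hn_inj hn i r%:Z (fun=> r%:Z).
have [|y [Ry y0 _ yE]] := quot m.
  by move=> j; have [->|/mj//] := eqVneq j i; rewrite mi.
have [l yl] := order_at_exists (n i) (span_laurent Ry) y0.
have := order_at_uniq (order_atM (gE (n i)) yl); rewrite -yE.
move=> /(_ _ (order_at_monomial k (n i) m)); rewrite mi => <-.
rewrite lerDl; have [_ _ [u yu <-]] := yl.
by have /spanP[_ /(_ u yu)/semigroupP] := Ry.
Qed.

Section Resolution.
Variable Sigma : set (set 'cV[RR]_d).
Hypothesis hSigma : is_log_resolution sigma a Sigma.

Lemma fan_ray_cone v : fan_rays Sigma v -> exists2 c : 'I_s -> RR,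
  forall i, 0 <= c i & real v = \sum_i c i *: real (n i).
Proof.
move=> [_ Sv]; have : sigma (real v).
  rewrite -(res_support hSigma); exists (ray v) => //.
  by exists 1 => //; rewrite scale1r.
by rewrite (cone_genP hsigma hn) => -[c c0 vE]; exists c.
Qed.

(** Rays of [Sigma] lie in sigma, so they take nonnegative integral values on the exponents of [a],
    and the minimum is attained. *)
Lemma ideal_ord_min v : fan_rays Sigma v -> exists m, [/\ a (mon m),
  ideal_ord a v = pairing m v & forall u, a (mon u) ->
    pairing m v <= pairing u v].
Proof.
move=> Sv; have [c c0 vE] := fan_ray_cone Sv.
have v_ge0 u : a (mon u) -> 0 <= pairing u v.
  move=> au; rewrite -(ler0z RR) -pairing_intr vE.
  rewrite pairing_sumr sumr_ge0 // => i _; rewrite pairingZr mulr_ge0 //.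
  by rewrite pairing_intr ler0z exponent_ge0.
pose Q (l : nat) := `[< exists2 u, a (mon u) & pairing u v = l%:Z >].
have exQ : exists l, Q l.
  have [u au] := toric_ideal_exponent; exists `|pairing u v|%N; apply/asboolP.
  by exists u => //; rewrite gez0_abs // v_ge0.
case: (ex_minnP exQ) => l /asboolP[m am ml] lmin.
have mmin u : a (mon u) -> pairing m v <= pairing u v.
  move=> au; rewrite ml -[leRHS]gez0_abs ?v_ge0 // lez_nat; apply: lmin;
    apply/asboolP.
  by exists u => //; rewrite gez0_abs // v_ge0.
exists m; split=> //; apply: ideal_ordE => // f /toric_ideal_span.
by apply: sub_span => u; exact: mmin.
Qed.

(** For integral j, the condition -j <= ceil(x) means -j - 1 < x. Rounding up thus makes the
    inequality strict, and the 1 it gains cancels the coefficient -1 of D_v in K_X, leaving <w, v>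
    from the pullback of K_Y. *)
Lemma multiplier_condition m v : fan_rays Sigma v ->
  (- Num.ceil (relative_canonical r g v - (ideal_ord a v)%:Q) <= pairing m v) =
  ((ideal_ord a v)%:~R < pairing (real m + w) (real v)).
Proof.
move=> Sv; have [c c0 vE] := fan_ray_cone Sv; have [m0 [m0n gE]] :=
  canonical_generator.
have wv : (pairing m0 v)%:~R = r%:R * pairing w (real v) :> RR.
  rewrite -pairing_intr vE !pairing_sumr mulr_sumr.
  apply: eq_bigr => i _; rewrite !pairingZr hw mulr1.
  by rewrite pairing_intr m0n mulrC.
rewrite /relative_canonical gE lerNl -ltzD1 -ltrBlDr ceil_gt_int.
rewrite pairingDl pairing_intr.
set j := pairing m v; set o := ideal_ord a v.
have rQ : 0 < r%:Q by rewrite ltr0z ltz_nat.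
have rR : 0 < r%:R :> RR by rewrite ltr0n.
rewrite -[RHS]ltrBlDl -[RHS](ltr_pM2l rR) -wv.
(* An inequality between integers mediates between [rat], where the coefficients of the divisor
   live, and [RR]. *)
transitivity (r%:Z * (o - j) < pairing m0 v); last by rewrite -(ltr_int RR)
  intrM intrB.
rewrite -(ltr_int rat) intrM intrB -ltr_pdivlMl // mulrC.
rewrite !intrD !intrN; apply/idP/idP; lra.
Qed.

(** The exponent 0 of 1 = sum of u_i v_i splits as x + y with x in the support of some u_i and y in
    that of v_i. On tau, x is at least some exponent m of [a], while y + u >= 0 for every exponent u
    of [a]; hence m <= x = -y <= u there. *)
Lemma resolution_invertible tau : Sigma tau -> exists2 m, a (mon m) &
  forall u, a (mon u) -> forall x, tau x -> pairing (real m) x <= pairing (real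
    u) x.
Proof.
move=> St; have [t [u [v [uI vA uv1]]]] := res_invertible hSigma St.
pose A := [set m | exists2 m', a (mon m') & dual_lattice_points tau (m - m')].
have uS i : monomial_span A (u i).
  apply: (submodule_gen_min _ _ (uI i)).
    split; [exact: span0|exact: spanD|move=> x y Rx Ay].
    rewrite mulrC; apply: spanM Ay Rx => m m' [m1 am1 h] h'; exists m1 => //.
    move=> z tz; rewrite addrAC map_mxD pairingDl addr_ge0 //;
      [exact: h|exact: h'].
  move=> f /toric_ideal_span; apply: sub_span => m am; exists m => //.
  by move=> z tz; rewrite subrr map_mx0 pairing0l.
have [m1 am1] := toric_ideal_exponent.
have aI m : a (mon m) -> submodule_gen (toric_ring k tau) a (mon m).
  exact: sub_submodule_gen.
have vl i : laurent (v i).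
  have := vA i _ (aI _ am1) => /span_laurent vm.
  rewrite -(mulfK (monomial_neq0 k m1) (v i)) -monomialN.
  by apply: laurentM => //; exact: span_monomial.
have : monomial_span [set m | exists i x y, [/\ coef (u i) x != 0,
  coef (v i) y != 0 & m = x + y]]
    (\sum_i u i * v i).
  apply: span_sum => i _.
  have us : monomial_span [set m | coef (u i) m != 0] (u i).
    by apply/spanP; split=> //; exact: span_laurent (uS i).
  have vs : monomial_span [set m | coef (v i) m != 0] (v i) by apply/spanP;
    split.
  by apply: spanM us vs => x y ux vy; exists i, x, y.
rewrite uv1 -(monomial0 k d) => /spanP[_ /(_ 0)];
  rewrite coef_monomial eqxx oner_eq0.
move=> /(_ isT)[i [x [y [ux vy xy]]]].
have /spanP[_ /(_ x ux)[m am xm]] := uS i.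
exists m => // u' au' z tz.
have /spanP[_ /(_ (y + u'))] := vA i _ (aI _ au').
rewrite mulrC coef_monomialM // addrK => /(_ vy) /(_ z tz).
have := xm z tz; rewrite !map_mxD !map_mxN !pairingDl !pairingNl.
have : pairing (real x) z + pairing (real y) z = 0.
  by rewrite -pairingDl -map_mxD -xy map_mx0 pairing0l.
lra.
Qed.

(** For the converse, a nonzero x in sigma is a nonnegative combination of the ray generators of one
    cone of [Sigma], on which a single exponent [m1] is minimal. The strict inequalities at the rays
    add up because some coefficient is positive. *)
Lemma multiplier_support m :
  Int_P (real m + w) <-> forall v, fan_rays Sigma v ->
    (ideal_ord a v)%:~R < pairing (real m + w) (real v).
Proof.
split=> [Pm v Sv|h].
  have [c c0 vE] := fan_ray_cone Sv; have [u [au -> umin]] := ideal_ord_min Sv.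
  have v0 : real v != 0 by rewrite real_eq0; apply: primitive_neq0; case: Sv.
  rewrite vE in v0 *; have [u' au'] := newton_interior_support Pm c0 v0.
  apply: le_lt_trans; rewrite -vE pairing_intr ler_int.
  exact: umin.
apply: newton_support_interior => c c0; set x := \sum_i _ => x0.
have : sigma x by rewrite (cone_genP hsigma hn); exists c.
rewrite -(res_support hSigma) => -[tau St tx].
have [B Bu [I tE]] := res_regular hSigma St.
pose V := invmx B.
have rowcol l j : pairing (row l V) (col j B) = (l == j)%:R.
  have /matrixP/(_ l j) := mulVmx Bu; rewrite !mxE pairingE => <-.
  by apply: eq_bigr => z _; rewrite !mxE.
have tau_comb (b : 'I_d -> RR) : (forall i, 0 <= b i) ->
    tau (\sum_(i in I) b i *: real (col i B)).
  by move=> b0; rewrite tE; exists b.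
have tau_col i (b : RR) : i \in I -> 0 <= b -> tau (b *: real (col i B)).
  move=> iI b0; have -> : b *: real (col i B) =
      \sum_(j in I) (if j == i then b else 0) *: real (col j B).
    rewrite (bigD1 i) //= eqxx big1 ?addr0 // => j /andP[_ /negPf->].
    by rewrite scale0r.
  by apply: tau_comb => j; case: ifP.
have colB i : i \in I -> fan_rays Sigma (col i B).
  move=> iI; split.
    move=> e z colE; apply/unitrPr; exists (pairing (row i V) z).
    by rewrite -pairingZr -colE rowcol eqxx.
  apply: (fan_faces (res_fan hSigma) St).
  (* A sum of members of the dual basis of the columns of [B]; on the cone it vanishes exactly along
     the ray of column i. *)
  pose rho := \sum_(j in I | j != i) row j V.
  have rhoE l : l \in I -> pairing (real rho) (real (col l B)) = (l != i)%:R.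
    move=> lI; rewrite pairing_intr pairing_suml.
    under eq_bigr do rewrite rowcol.
    have [->|li] := eqVneq l i.
      by rewrite big1 // => j /andP[_ /negPf->].
    rewrite (bigD1 l) ?lI //= eqxx big1 // => j /andP[_ /negPf->] //.
  have combE (b : 'I_d -> RR) : pairing (real rho) (\sum_(l in I) b l *: real
    (col l B)) =
      \sum_(l in I) b l * (l != i)%:R.
    by rewrite pairing_sumr; apply: eq_bigr => l lI; rewrite pairingZr rhoE.
  exists (real rho).
    move=> z; rewrite tE => -[b b0 ->]; rewrite combE.
    by apply: sumr_ge0 => l _; rewrite mulr_ge0 ?ler0n.
  rewrite predeqE => z; split=> [[b b0 ->]|[]].
    by split; [exact: tau_col|rewrite pairingZr rhoE // eqxx mulr0].
  rewrite tE => -[b b0 ->]; rewrite combE => /eqP.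
  rewrite psumr_eq0 => [/allP bz|l _]; last by rewrite mulr_ge0 ?ler0n.
  exists (b i) => //; rewrite (bigD1 i) //= big1 ?addr0 // => l /andP[lI li].
  have := bz l (mem_index_enum _); rewrite lI li mulr1 => /eqP->.
  by rewrite scale0r.
have [m1 am1 m1min] := resolution_invertible St.
exists m1 => //.
have lt l : l \in I -> pairing (real m1) (real (col l B)) <
    pairing (real m + w) (real (col l B)).
  move=> lI; apply: le_lt_trans (h _ (colB l lI)).
  have [u [au -> _]] := ideal_ord_min (colB l lI).
  rewrite -pairing_intr; apply: m1min => //.
  by rewrite -[real _]scale1r; exact: tau_col.
move: tx x0; rewrite tE => -[b b0 ->] x0.
have [l lI bl] : exists2 l, l \in I & 0 < b l.
  apply: contrapT => nb; move/eqP: x0; apply; apply: big1 => l lI.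
  have /eqP -> : b l == 0; last by rewrite scale0r.
  by rewrite eq_le b0 andbT leNgt; apply/negP => bl; apply: nb; exists l.
rewrite !pairing_sumr (bigD1 l) //= [ltRHS](bigD1 l) //= ltr_leD //.
  by rewrite !pairingZr ltr_pM2l // lt.
by apply: ler_sum => j /andP[jI _]; rewrite !pairingZr ler_wpM2l // ltW // lt.
Qed.

Lemma multiplier_idealE :
  multiplier_ideal Sigma r g a = monomial_span [set m | Int_P (real m + w)].
Proof.
rewrite /multiplier_ideal divisor_sectionsE; congr monomial_span.
rewrite predeqE => m; rewrite /= multiplier_support.
by split=> h v Sv; have := h v Sv; rewrite multiplier_condition.
Qed.

End Resolution.
End Gorenstein.

(** * Lower bound: monomials of tau via inverse Frobenius maps *)

Hypothesis hp : p \in [pchar k].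

Lemma ideal_pow_monomial (t : nat) (al : 'I_t -> 'rV[int]_d) (c : 'I_t -> nat) :
  (forall j, a (mon (al j))) ->
  ideal_pow R a (\sum_j c j) (mon (\sum_j al j *+ c j)).
Proof.
move=> aal; have [l [lc la ->]] : exists l : seq 'rV[int]_d,
  [/\ size l = (\sum_j c j)%N,
    forall u, u \in l -> a (mon u) & \sum_j al j *+ c j = \sum_(u <- l) u].
  elim: (index_enum _) => [|j r [l [lc la lE]]].
    by exists [::]; split; rewrite ?big_nil.
  exists (nseq (c j) (al j) ++ l); split.
  - by rewrite size_cat size_nseq big_cons lc.
  - by move=> u; rewrite mem_cat => /orP[/nseqP[->]|/la].
  - rewrite big_cons big_cat lE /=; congr (_ + _).
    by rewrite big_nseq -[LHS]addr0 -iter_addr.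
rewrite -lc; apply: sub_submodule_gen.
exists (fun i => mon (tnth (in_tuple l) i)) => [i|]; first exact/la/mem_tnth.
rewrite monomial_sum; apply/esym.
exact: (big_tuple _ _ (in_tuple l) xpredT (fun m => mon m)).
Qed.

Lemma tau_monomial m : Int_P (real m + w) -> tau R p a (mon m).
Proof.
have [xi xiP] := interior_lattice_point hsigma hn;
  have [m0 am0] := toric_ideal_exponent.
move=> /(@interior_shift RR d s n xi xiP [set m | a (mon m)] _ m0 am0)[].
  by move=> m' u /= am' /semigroupP Su; exact: toric_ideal_exponentD.
move=> eta eta0 [t [lam [x [lam0 lam1 xA yE]]]].
have /choice[al alP] : forall j, exists u, a (mon u) /\ real u = x j.
  by move=> j; have [u au <-] := xA j; exists u.
have xi1 i : 1 <= (pairing xi (n i))%:~R :> RR.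
  by rewrite -[1]/(1%:~R) ler_int; exact: xiP.
have sumE i : \sum_j lam j * (pairing (al j) (n i))%:~R =
    (pairing m (n i))%:~R + 1 - eta * (pairing xi (n i))%:~R :> RR.
  transitivity (pairing (real m + w - eta *: real xi) (real (n i))).
    rewrite yE pairing_suml; apply: eq_bigr => j _.
    by rewrite pairingZl -(alP j).2 pairing_intr.
  by rewrite pairingBl pairing_shift intrD pairingZl pairing_intr.
have al0 i j : 0 <= pairing (al j) (n i) by apply: exponent_ge0;
  exact: (alP j).1.
have Sm : S m.
  apply/semigroupP => i; rewrite -ltzD1 -(ltr0z RR) intrD.
  have : 0 <= \sum_j lam j * (pairing (al j) (n i))%:~R :> RR.
    by apply: sumr_ge0 => j _; rewrite mulr_ge0 // ler0z.
  rewrite sumE subr_ge0; apply: lt_le_trans; rewrite mulr_gt0 //.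
  by rewrite ltr0z; exact: xiP.
split=> [|I [IR Im]]; first exact/toric_ring_monomial.
have [I0 ID IM] := Im.
split=> [|y [Ry [c cR [e0 hy]]]]; first exact/toric_ring_monomial.
have [Rc c0] : R c /\ c <> 0 by apply/domain_ring_circ; [exact: toric_ring0|].
have lc := span_laurent Rc.
have [g0 cg0] : exists m, coef c m != 0 by apply: laurent_neq0 => //; exact/eqP.
have j0 : 'I_t.
  apply: (@Ordinal _ 0%N); rewrite lt0n; apply/eqP => t0.
  move/eqP: lam1; rewrite big1 1?eq_sym ?oner_eq0 // => -[j jt] _.
  by exfalso; move: jt; rewrite t0.
have [supp [_ suppP _]] := coef_support lc.
(* Once q > D, no exponent of [c] other than [g0] is congruent to [g0] modulo q, so the map will see
   a single term of [c]. *)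
pose D := (\sum_(u <- supp) \sum_j `|u ord0 j - g0 ord0 j|)%N.
(* [C] bounds what [g0] and the rounding of the weights contribute to <b, n_i>; the gain available
   is at least eta q. *)
pose C : RR := \sum_i (`|(pairing g0 (n i))%:~R| + t%:R * (pairing (al j0) (n
  i))%:~R).
(* Since e < p^e = q, the three summands give e >= e0, q > C / eta and q > D. *)
pose e := (e0 + ((Num.truncn (C / eta)).+1 + D))%N.
have p1 : (1 < p)%N by have := hp; rewrite inE => /andP[/prime_gt1].
pose q := (p ^ e)%N; have qe : (e < q)%N by exact: ltn_expl.
have qC : C < eta * q%:R.
  rewrite mulrC -ltr_pdivrMr //; apply: (lt_le_trans (truncnS_gt _)).
  by rewrite ler_nat; apply: leq_trans (ltnW qe); rewrite /e addnCA leq_addr.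
have qD : (D < q)%N by apply: leq_ltn_trans qe; rewrite /e addnA leq_addl.
have q0 : (0 < q)%N by exact: leq_ltn_trans qe.
pose fl j := Num.truncn (q%:R * lam j).
have qlam0 j : 0 <= q%:R * lam j by rewrite mulr_ge0.
have r_le j : (fl j)%:R <= q%:R * lam j by rewrite truncn_le.
have r_gt j : q%:R * lam j <= (fl j)%:R + 1.
  by rewrite -[1]/(1%:R) -natrD addn1 ltW // truncnS_gt.
have qE : q%:R = \sum_j q%:R * lam j by rewrite -mulr_sumr lam1 mulr1.
have rq : (\sum_j fl j <= q)%N.
  by rewrite -(ler_nat RR) natr_sum qE ler_sum.
(* Rounding down loses less than one unit per weight, at most t in all. The deficit is given to
   [j0], so that the multiplicities add up to exactly q and [u] is an exponent of a^q. *)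
pose del := (q - \sum_j fl j)%N.
have del_le : (del%:R : RR) <= t%:R.
  rewrite natrB // natr_sum {1}qE -sumrB -[t in leRHS]card_ord -sumr_const.
  by apply: ler_sum => j _; rewrite lerBlDl.
pose fl' j := (fl j + (j == j0) * del)%N.
have sumr' : (\sum_j fl' j)%N = q.
  rewrite big_split /= (bigD1 j0 (F := fun j => ((j == j0) * del)%N)) //= eqxx
    mul1n.
  rewrite [X in (_ + (_ + X))%N]big1 ?addn0 ?subnKC // => j jj0.
  by rewrite (negPf jj0).
pose u := \sum_j al j *+ fl' j.
have au : ideal_pow R a q (mon u).
  by rewrite -sumr'; apply: ideal_pow_monomial => j; exact: (alP j).1.
pose b := g0 + u - m *+ q.
have bq i : pairing b (n i) < q%:Z.
  rewrite -(ltr_int RR) /b pairingBl pairingDl pairingMn /u pairing_suml.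
  rewrite rmorphB rmorphD rmorphMn /= rmorph_sum /=.
  have : \sum_j (pairing (al j *+ fl' j) (n i))%:~R <=
      q%:R * ((pairing m (n i))%:~R + 1 - eta * (pairing xi (n i))%:~R) +
      t%:R * (pairing (al j0) (n i))%:~R :> RR.
    rewrite -sumE mulr_sumr.
    have -> : t%:R * (pairing (al j0) (n i))%:~R =
        \sum_j (if j == j0 then t%:R * (pairing (al j0) (n i))%:~R else 0) :>
          RR.
      by rewrite -big_mkcond big_pred1_eq.
    rewrite -big_split; apply: ler_sum => j _ /=.
    rewrite pairingMn rmorphMn /= -mulr_natl natrD mulrDl mulrA.
    apply: lerD; first by rewrite ler_wpM2r ?ler0z.
    case: eqP => [->|_]; last by rewrite mul0n mul0r.
    by rewrite mul1n ler_wpM2r // ler0z.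
  have : (pairing g0 (n i))%:~R + t%:R * (pairing (al j0) (n i))%:~R <= C.
    rewrite /C (bigD1 i) //=; apply: ler_wpDr.
      by apply: sumr_ge0 => l _; rewrite addr_ge0 ?mulr_ge0 ?ler0z.
    by rewrite lerD2r ler_norm.
  have : eta * q%:R <= q%:R * (eta * (pairing xi (n i))%:~R).
    by rewrite mulrA [q%:R * eta]mulrC ler_peMr // mulr_ge0 // ltW.
  rewrite -[(q%:Z)%:~R]/(q%:R) -[(pairing m (n i))%:~R *+ q]mulr_natl; move: qC.
  set Q : RR := q%:R; set M := (pairing m (n i))%:~R;
    set X := (pairing xi (n i))%:~R.
  set Y := \sum_j _; set T := t%:R * _; set G := _%:~R.
  clearbody Q M X Y T G; lra.
have qnat : [pchar k].-nat q by rewrite /q pnatX pnatE ?hp //; have := hp;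
  rewrite inE => /andP[].
have frobk (v1 v2 : k) : (v1 + v2) ^+ q = v1 ^+ q + v2 ^+ q by exact:
  exprDn_pchar.
have frobK (v1 v2 : K) : (v1 + v2) ^+ q = v1 ^+ q + v2 ^+ q.
  apply: exprDn_pchar; apply: sub_in_pnat qnat => l _ lk.
  exact: (rmorph_pchar (@cst k d)).
have [pi [piD piZ pic]] := frobenius_functional q0 frobk cg0.
pose phi := cartier q b pi.
have phiR f : R f -> R (phi f).
  have RE (f' : K) : R f' <-> monomial_span [set m | forall i,
    0 <= pairing m (n i)] f'.
    by split; apply: sub_span => v /=; rewrite semigroupP.
  by rewrite !RE; exact: cartier_span.
have phi_frob F : frobenius_power R I q F -> I (phi F).
  (* [phi] is not R-linear, so the preimage of [I] is replaced by its part stable under R, to which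
     the minimality of the Frobenius power applies. *)
  pose J := [set F | R F /\ forall r, R r -> I (phi (r * F))].
  have Jm : is_submodule R J.
    split.
    - split=> [|r _]; first exact: toric_ring0.
      rewrite mulr0; suff -> : phi 0 = 0 by [].
      have : phi (0 + 0) = phi 0 + phi 0 by apply: cartierD => //; exact: span0.
      by rewrite addr0 => /eqP; rewrite -subr_eq0 opprD addrA subrr sub0r
        oppr_eq0 => /eqP.
    - move=> f g [Rf hf] [Rg hg]; split=> [|r Rr]; first exact: spanD.
      rewrite mulrDr /phi cartierD //; first by apply: ID;
        [exact: hf|exact: hg].
        by apply: span_laurent; exact: toric_ringM.
      by apply: span_laurent; exact: toric_ringM.
    - move=> r f Rr [Rf hf]; split=> [|r' Rr']; first exact: toric_ringM.
      by rewrite mulrA; apply: hf; exact: toric_ringM.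
  have JI : [set x ^+ q | x in I] `<=` J.
    have RX f j : R f -> R (f ^+ j).
      move=> Rf; elim: j => [|j IH]; last by rewrite exprS; exact: toric_ringM.
      by rewrite expr0; exact: toric_ring1.
    move=> _ [f If <-]; have Rf := IR _ If; split; first exact: RX.
    move=> r Rr; rewrite mulrC /phi cartierM //; last 2 first.
    - exact: span_laurent Rf.
    - exact: span_laurent Rr.
    by rewrite mulrC; apply: IM => //; exact: phiR.
  move=> /(submodule_gen_min Jm JI)[_ /(_ 1 toric_ring1)]; rewrite mul1r //.
have lu : laurent (mon u) by exact: span_monomial.
have phic : phi (c * mon u) = mon m.
  have lcu : laurent (c * mon u) by exact: laurentM.
  have [l1 c1] := cartierP b q0 piD lcu.
  apply: coef_inj => // [|m']; first exact: span_monomial.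
  rewrite c1 mulrC coef_monomialM // coef_monomial.
  (* The coefficient of [phi (c * mon u)] at m' is thus read off from that of [c] at q (m' - m) +
     g0. For m' = m this is the coefficient at [g0], which [pi] sends to 1. *)
  have -> : m' *+ q + b - u = (m' - m) *+ q + g0.
    by rewrite /b mulrnBl; apply/rowP => j; rewrite !mxE; ring.
  have [->|m'm] := eqVneq m' m; first by rewrite subrr mul0rn add0r pic.
  have -> : coef c ((m' - m) *+ q + g0) = 0.
    apply/eqP; apply: contraT; rewrite -suppP => vs.
    move/negP: m'm; case; apply/eqP/rowP => j.
    have : (`|(((m' - m) *+ q + g0) ord0 j - g0 ord0 j)%R| <= D)%N.
      by rewrite /D (big_rem _ vs) /= (bigD1 j) //= -addnA leq_addr.
    have -> : ((m' - m) *+ q + g0) ord0 j - g0 ord0 j = (m' ord0 j - m ord0 j)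
      * q%:Z.
      by rewrite mxE addrK mulmxnE !mxE -mulr_natr natz.
    rewrite abszM absz_nat => zD; apply/eqP; rewrite -subr_eq0 -absz_eq0 -leqn0
      leqNgt.
    apply/negP => z0; have := leq_trans (leq_pmull q z0) zD.
    by rewrite leqNgt qD.
  have := piD 0 0; rewrite addr0 => /eqP.
  by rewrite -subr_eq0 opprD addrA subrr sub0r oppr_eq0 => /eqP.
have := phi_frob _ (hy e (leq_addr _ _) _ au).
rewrite -/q -mulrA [y ^+ q * _]mulrC mulrA [c * mon u * _]mulrC /phi cartierM
  //.
- by rewrite -/phi phic mulrC.
- exact: span_laurent Ry.
- exact: laurentM.
Qed.

Lemma tau_submodule : is_submodule R (tau R p a).
Proof.
split.
- split=> [|I [_ [I0 _ _]]]; first exact: toric_ring0.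
  by split=> [|y _]; [exact: toric_ring0|rewrite mul0r].
- move=> x y [Rx hx] [Ry hy]; split=> [|I II]; first exact: spanD.
  have [_ xI] := hx I II; have [_ yI] := hy I II; have [_ [_ ID _]] := II.
  split=> [|z Iz]; first exact: spanD.
  by rewrite mulrDl; apply: ID; [exact: xI|exact: yI].
- move=> x y Rx [Ry hy]; split=> [|I II]; first exact: toric_ringM.
  have [_ yI] := hy I II; have [_ [_ _ IM]] := II.
  split=> [|z Iz]; first exact: toric_ringM.
  by rewrite -mulrA; apply: IM => //; exact: yI.
Qed.

Lemma tau_span : tau R p a = monomial_span [set m | Int_P (real m + w)].
Proof.
rewrite predeqE => z; split=> [tz|].
  have [Rz _] := tz; apply/spanP; split; first exact: span_laurent Rz.
  by move=> m; exact: tau_coef.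
have [t0 tD tM] := tau_submodule; elim/span_ind: z / => // c m Tm.
apply: tM; last exact: tau_monomial.
rewrite -[cst c]mulr1 -(monomial0 k d); exact: span_term semigroup0.
Qed.

Lemma tau_toric : is_toric_ideal sigma (tau R p a).
Proof.
exists [set m | Int_P (real m + w)].
  by move=> m /tau_monomial[/toric_ring_monomial].
rewrite predeqE => z; split; last first.
  apply: submodule_gen_min; first exact: tau_submodule.
  by move=> _ [m Tm <-]; exact: tau_monomial.
rewrite tau_span; have [t0 tD tM] :=
  submodule_gen_submodule R [set mon m | m in [set m | Int_P (real m + w)]].
elim/span_ind: z / => // c m Tm; apply: tM.
  rewrite -[cst c]mulr1 -(monomial0 k d); exact: span_term semigroup0.
by apply: sub_submodule_gen; exists m.
Qed.

End TauToric.

Theorem theorem4p8 (RR : realType) (k : fieldType) (p : nat)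
  (hp : p \in [pchar k])
  (d : nat) (sigma : set 'cV[RR]_d)
  (hsigma : strongly_convex_rational_cone sigma)
  (s : nat) (n : 'I_s -> 'cV[int]_d)
  (hn_inj : injective n) (hn : range n = fan_rays (faces sigma))
  (r : nat) (g : ratfun k d) (hr : (0 < r)%N)
  (hg : canonical_power k sigma r = principal (toric_ring k sigma) g)
  (w : 'rV[RR]_d) (hw : forall i, pairing w (map_mx intr (n i)) = 1)
  (a : set (ratfun k d)) (ha : is_toric_ideal sigma a) (ha0 : a <> [set 0]) :
  let R := toric_ring k sigma in
  let Int_P := relative_interior (newton_polygon RR a) in
  [/\ is_toric_ideal sigma (tau R p a),
      forall m : 'rV[int]_d,
        tau R p a (monomial k m) <-> Int_P (map_mx intr m + w)
    & forall Sigma : set (set 'cV[RR]_d), is_log_resolution sigma a Sigma ->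
        tau R p a = multiplier_ideal Sigma r g a /\
        forall m : 'rV[int]_d,
          Int_P (map_mx intr m + w) <->
          multiplier_ideal Sigma r g a (monomial k m)].
Proof.
move=> R Int_P.
have tauP m : tau R p a (monomial k m) <-> Int_P (map_mx intr m + w).
  split=> [tm|]; last by apply: (tau_monomial hsigma hn hw ha ha0 hp).
  have := tau_coef hsigma hn_inj hn hw ha ha0 tm (m := m).
  by rewrite coef_monomial eqxx oner_eq0; apply.
split=> //; first exact: (tau_toric hsigma hn_inj hn hw ha ha0 hp).
move=> Sigma hSigma.
have tauE : tau R p a = multiplier_ideal Sigma r g a.
  rewrite (multiplier_idealE hsigma hn_inj hn hw ha ha0 hr hg hSigma).
  exact: (tau_span hsigma hn_inj hn hw ha ha0 hp).
by split=> // m; rewrite -tauE; apply: iff_sym.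
Qed.
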